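(* Let $k$ be a field of characteristic zero and let $m,r$ be integers with $1\leq r\leq m-3$. Let $J\subset R=k[x_1,\ldots,x_{2m-r-1}]$ be the gradient ideal of the determinant of $\mathcal{H}_m[r]$, and let $Q=(x_m,x_{m+1},\ldots,x_{2m-r-1})$ be the ideal generated by the $m-r$ nonzero variables of the last column of $\mathcal{H}_m[r]$. Then: (a) The minimal primes of $R/J$ are $Q$ and $P:=I_{m-1}(\mathcal{H}_m[r])$. (b) $J$ is not a reduction of $P$. (c) The unmixed and minimal components of $J$ coincide if and only if $r=m-3$.
   Context: $\mathcal{H}_m[r]$ denotes the $m\times m$ matrix over $R$ whose $(i,j)$ entry is the variable $x_{i+j-1}$ if $i+j\leq 2m-r$ and $0$ if $i+j>2m-r$. The gradient ideal of $f\in R$ is the ideal generated by all partial derivatives $\partial f/\partial x_i$, $1\leq i\leq 2m-r-1$. $I_{m-1}(\mathcal{M})$ is the ideal generated by the $(m-1)\times(m-1)$ minors of $\mathcal{M}$. An ideal $J\subset I$ is a reduction of $I$ if $I^{n+1}=JI^n$ for some $n\geq 0$. The minimal component of $J$ is the intersection of the primary components of $J$ belonging to its minimal primes; the unmixed component of $J$ is the intersection of the primary components of $J$ whose associated primes have codimension equal to $\operatorname{codim} J$. *)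

(* Defs.v *)
From mathcomp Require Import all_boot all_order all_algebra.
From mathcomp Require Import boolp classical_sets.
From mathcomp Require Import mpoly.

Set Implicit Arguments.
Unset Strict Implicit.
Unset Printing Implicit Defensive.

Import GRing.Theory.

Local Open Scope classical_set_scope.
Local Open Scope ring_scope.

Section Ideals.
Variable R : comNzRingType.
Implicit Types (I J P q : set R).

(* Possibly improper ideals; MathComp's [idealr_closed] also asks that
   [1 \notin I]. *)
Definition is_ideal I : Prop :=
  I 0 /\ forall a u v, I u -> I v -> I (a * u + v).

Definition ideal_gen (A : set R) : set R := smallest is_ideal A.

Definition ideal_mul I J : set R :=
  ideal_gen [set x | exists a b, [/\ I a, J b & x = a * b]].

Definition ideal_exp I (n : nat) : set R := iter n (ideal_mul I) setT.

Definition is_reduction J I : Prop :=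
  J `<=` I /\ exists n, ideal_exp I n.+1 = ideal_mul J (ideal_exp I n).

Definition prime_ideal P : Prop :=
  idealr_closed (mem P) /\ prime_idealr_closed (mem P).

Definition minimal_prime J P : Prop :=
  [/\ prime_ideal P, J `<=` P &
      forall P', prime_ideal P' -> J `<=` P' -> P' `<=` P -> P' = P].

Definition radical I : set R := [set f | exists n, I (f ^+ n)].

Definition primary_ideal q : Prop :=
  [/\ is_ideal q, ~ q 1 & forall f g, q (f * g) -> q f \/ radical q g].

(* The height of [P] is at least [n]. *)
Definition height_ge P (n : nat) : Prop :=
  exists p : nat -> set R,
    [/\ forall i, (i <= n)%N -> prime_ideal (p i),
        forall i, (i < n)%N -> p i `<` p i.+1
      & p n = P].

(* The codimension of [I] is the minimum of the heights of the primes
   containing [I]. *)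
Definition codim_ge I (n : nat) : Prop :=
  forall P, prime_ideal P -> I `<=` P -> height_ge P n.

Definition has_codim I (c : nat) : Prop := codim_ge I c /\ ~ codim_ge I c.+1.

Definition irredundant_primary_decomposition J (n : nat) (q : 'I_n -> set R)
  : Prop :=
  [/\ forall i, primary_ideal (q i),
      J = \bigcap_i q i,
      injective (fun i => radical (q i))
    & forall i, ~ \bigcap_(j in [set j | j != i]) q j `<=` q i].

(* The intersection of the primary components of [J] whose associated prime
   satisfies [S].  Below, [S] only selects minimal primes of [J]; the
   components belonging to these are determined by [J], so the set does not
   depend on the decomposition that is existentially quantified. *)
Definition component J (S : set R -> Prop) : set R :=
  [set f | exists (n : nat) (q : 'I_n -> set R),
     irredundant_primary_decomposition J q /\
     forall i, S (radical (q i)) -> q i f].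

Definition minimal_component J : set R := component J (minimal_prime J).

Definition unmixed_component J : set R :=
  component J (fun P => exists c, has_codim J c /\ has_codim P c).

Definition minors_ideal (t m n : nat) (M : 'M[R]_(m, n)) : set R :=
  ideal_gen [set d | exists (f : 'I_t -> 'I_m) (g : 'I_t -> 'I_n),
    [/\ {homo f : x y / (x < y)%N}, {homo g : x y / (x < y)%N}
      & d = \det (mxsub f g M)]].

End Ideals.

Definition gradient_ideal (k : fieldType) (n : nat) (f : {mpoly k[n]})
  : set {mpoly k[n]} := ideal_gen [set mderiv i f | i in setT].

(* Indices are 0-based: 'X_t is x_(t+1), so the 1-based entry x_(i+j-1) becomes
   'X_(i+j), and the 1-based condition i+j <= 2m-r becomes i+j < 2m-r-1. *)
Definition hankel (k : fieldType) (m r : nat) : 'M[{mpoly k[2 * m - r - 1]}]_m :=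
  \matrix_(i, j)
    if (insub (i + j)%N : option 'I_(2 * m - r - 1)) is Some t then 'X_t else 0.

(* The ideal (x_m, ..., x_(2m-r-1)). *)
Definition last_column_ideal (k : fieldType) (m r : nat)
  : set {mpoly k[2 * m - r - 1]} :=
  ideal_gen [set 'X_t | t in [set t : 'I_(2 * m - r - 1) | (m <= t.+1)%N]].
Arguments last_column_ideal : clear implicits.

(* Main.v *)
Require Import Defs.
From HB Require Import structures.
From mathcomp Require Import all_boot all_order all_algebra.
From mathcomp Require Import boolp classical_sets.
From mathcomp Require Import mpoly zify ring perm fraction.

(* Reverse the variables, w_j = x_(N-1-j).  The points where the Hankel matrix has corank two
   are the truncations of rational power series u(z) / c(z) with c(0) = 1, deg c <= m - 2 and
   deg u <= N - m - 2, so the coefficients of the generic such series define a ring morphism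
   whose kernel is prime and contains P.  That it equals P is proved by adding the variables
   w_0 one at a time: if f is in the kernel for N + 1 variables then f restricted to w_0 = 0
   is in the kernel for N, hence f = p + w_0 g with p in P and g again in the kernel, and P is
   homogeneous.  In the starting case N = m + 2, modulo P every polynomial is a combination of
   monomials of degree at most m - 2 in the middle variables x_(m-2), x_(m-1), x_m with
   coefficients in the other ones, and as many such monomials of each weight exist as there
   are partitions into parts at most m - 2, so they stay independent under the morphism.

   If a prime p contains J, then over the residue field at p the Hankel matrix is singular by
   Euler's formula.  If it has corank one its adjugate is a multiple of v v^T, and J = 0 says
   that v(z)^2 is divisible by z^N; then v H = 0 forces the last column to vanish.  So p
   contains P or Q.  P has height 3 and Q has height m - r, which gives (c); the case
   r < m - 3 needs the existence of a primary decomposition, hence Lasker-Noether. *)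

Set Implicit Arguments.
Unset Strict Implicit.
Unset Printing Implicit Defensive.

Import Order.TTheory GRing.Theory.

Local Open Scope classical_set_scope.
Local Open Scope ring_scope.

(** * Ideals and residue fields *)

Section IdealTheory.
Variable R : comNzRingType.
Implicit Types (I J P q : set R) (A : set R).

(** In the code [s] is m - 2 and [e] is N - m - 1, the number of coefficients of u. The generic
    series thus has s + e = N - 3 parameters, whence the height 3 of P. In the theorem e = m - 2 -
    r, so Q has height e + 2, and r = m - 3 means e = 1: exactly then both minimal primes have the
    same height. The main obstacle is to show that the minors generate the whole kernel. This is
    done by counting instead of computing leading terms: once w_0 is sent to 1, the images of the
    normal monomials of a given weight span a space whose dimension is their number, so they form a
    basis and a normal form in the kernel is zero. The exponent of w_0, lost in this way, is
    recovered from the degree. *)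

Lemma is_ideal0 I : is_ideal I -> I 0. Proof. by case. Qed.

Lemma is_idealD I u v : is_ideal I -> I u -> I v -> I (u + v).
Proof. by move=> [_ h] Iu Iv; rewrite -[u]mul1r; apply: h. Qed.

Lemma is_idealMl I a u : is_ideal I -> I u -> I (a * u).
Proof. by move=> [h0 h] Iu; rewrite -[a * u]addr0; apply: h. Qed.

Lemma is_idealMr I a u : is_ideal I -> I u -> I (u * a).
Proof. by move=> hI Iu; rewrite mulrC; apply: is_idealMl. Qed.

Lemma is_idealN I u : is_ideal I -> I u -> I (- u).
Proof. by move=> hI Iu; rewrite -mulN1r; apply: is_idealMl. Qed.

Lemma is_idealB I u v : is_ideal I -> I u -> I v -> I (u - v).
Proof. by move=> hI Iu Iv; apply: is_idealD => //; apply: is_idealN. Qed.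

Lemma is_ideal_sum I (T : Type) (r : seq T) (p : pred T) F : is_ideal I ->
  (forall i, p i -> I (F i)) -> I (\sum_(i <- r | p i) F i).
Proof.
by move=> hI hF; apply: big_ind => //; [exact: is_ideal0|move=> ? ?; exact: is_idealD].
Qed.

Lemma is_ideal_gen A : is_ideal (ideal_gen A).
Proof.
split=> [I [[]]//|a u v hu hv I hI]; have [hi _] := hI.
by apply: is_idealD => //; [apply: is_idealMl => //|]; [apply: hu|apply: hv].
Qed.

Lemma ideal_gen_mem A x : A x -> ideal_gen A x.
Proof. by move=> Ax I [_]; apply. Qed.

Lemma ideal_gen_sub A I : is_ideal I -> A `<=` I -> ideal_gen A `<=` I.
Proof. by move=> hI hA x; apply. Qed.

Lemma prime_ideal_is_ideal P : prime_ideal P -> is_ideal P.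
Proof.
move=> [[]]; rewrite in_setE => P0 _ hP _; split=> // a u v Pu Pv.
by have := hP a u v; rewrite !in_setE; apply.
Qed.

Lemma prime_ideal1 P : prime_ideal P -> ~ P 1.
Proof. by move=> [[_ /negP h _] _] h1; apply: h; rewrite in_setE. Qed.

Lemma prime_idealM P u v : prime_ideal P -> P (u * v) -> P u \/ P v.
Proof.
move=> [_ h] Puv; have := h u v; rewrite in_setE => /(_ Puv)/orP.
by rewrite !in_setE.
Qed.

Lemma prime_idealX P u n : prime_ideal P -> P (u ^+ n) -> P u.
Proof.
move=> hP; elim: n => [/(prime_ideal1 hP)//|n ih]; rewrite exprS.
by move/(prime_idealM hP) => [].
Qed.

Lemma prime_ideal_intro P : is_ideal P -> ~ P 1 ->
  (forall u v, P (u * v) -> P u \/ P v) -> prime_ideal P.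
Proof.
move=> [h0 h] h1 hM; split; first split.
- by rewrite in_setE.
- by apply/negP; rewrite in_setE.
- by move=> a u v; rewrite !in_setE; apply: h.
by move=> u v; rewrite in_setE => /hM H; apply/orP; rewrite !in_setE.
Qed.

Lemma kernel_prime_ideal (S : idomainType) (f : {rmorphism R -> S}) :
  prime_ideal [set x | f x = 0].
Proof.
apply: prime_ideal_intro => /=.
- split=> /= [|a u v hu hv]; first exact: rmorph0.
  by rewrite rmorphD rmorphM hu hv mulr0 addr0.
- by rewrite rmorph1; move/eqP; rewrite oner_eq0.
- by move=> u v /eqP; rewrite rmorphM mulf_eq0 => /orP[] /eqP ->; [left|right].
Qed.

End IdealTheory.

Section ResidueField.
Local Open Scope quotient_scope.
Variables (R : comNzRingType) (I : prime_idealr R).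
Local Notation Q := (Quotient.quot I).

(** The fraction field construction asks for an integral domain with a unit predicate and a total
    inverse, so both are chosen classically on the quotient. *)
Let unitQ : pred Q := fun x => `[< exists y, y * x = 1 >].
Let invQ (x : Q) : Q :=
  if pselect (exists y, y * x = 1) is left h then projT1 (cid h) else x.

Let mulVQ : {in unitQ, left_inverse 1 invQ *%R}.
Proof.
by move=> x /asboolP h; rewrite /invQ; case: pselect => // h'; case: cid.
Qed.

Let unitQP (x y : Q) : y * x = 1 -> unitQ x.
Proof. by move=> h; apply/asboolP; exists y. Qed.

Let invQ_out : {in [predC unitQ], invQ =1 id}.
Proof. by move=> x /asboolP h; rewrite /invQ; case: pselect. Qed.

HB.instance Definition _ := GRing.ComNzRing_hasMulInverse.Build Q
  mulVQ unitQP invQ_out.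
HB.instance Definition _ := GRing.ComUnitRing_isIntegral.Build Q
  (@Quotient.rquot_IdomainAxiom R I).

Lemma prime_idealr_kernel : exists (K : fieldType) (f : {rmorphism R -> K}),
  forall x, (f x == 0) = (x \in (I : pred R)).
Proof.
exists {fraction Q}, (@tofrac Q \o \pi_Q) => x /=.
by rewrite tofrac_eq0 -[x in RHS]subr0 Quotient.idealrBE -(rmorph0 (\pi_Q)).
Qed.

End ResidueField.

(** Membership in a prime becomes vanishing in a field, where rank arguments are available. *)
Lemma prime_ideal_kernel (R : comNzRingType) (P : set R) : prime_ideal P ->
  exists (K : fieldType) (f : {rmorphism R -> K}), forall x, P x <-> f x = 0.
Proof.
move=> [h1 h2]; pose S : R -> bool := mem P.
pose S1 := isIdealr.Build R S h1.
pose S2 := isPrimeIdealrClosed.Build R S h2.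
pose I : prime_idealr R := HB.pack S S1 S2.
have [K [f hf]] := prime_idealr_kernel I.
by exists K, f => x; split=> [Px|/eqP]; [apply/eqP|]; rewrite hf /= in_setE.
Qed.

(** * Primary decomposition *)

Section LaskerNoether.
Variable R : comNzRingType.
Implicit Types (I J P q : set R).

Hypothesis acc : forall I : nat -> set R, (forall i, is_ideal (I i)) ->
  (forall i, I i `<=` I i.+1) -> exists i, I i.+1 `<=` I i.

(** A counterexample would start, by dependent choice, a strictly ascending chain of ideals. *)
Lemma noetherian_ind (T : set R -> Prop) :
  (forall I, is_ideal I -> (forall J, is_ideal J -> I `<` J -> T J) -> T I) ->
  forall I, is_ideal I -> T I.
Proof.
move=> hT I0 hI0; apply: contrapT => nT0.
pose S := {I | is_ideal I /\ ~ T I}.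
have step (s : S) : exists s' : S, sval s `<` sval s'.
  case: s => I [hI nT] /=; apply: contrapT => hno; apply: nT; apply: hT => // J hJ hIJ.
  by apply: contrapT => nTJ; apply: hno; exists (exist _ J (conj hJ nTJ)).
have [f hf] := choice step.
pose c i := sval (iter i f (exist _ I0 (conj hI0 nT0))).
have hc i : c i `<` c i.+1 by apply: hf.
have hid i : is_ideal (c i) := (svalP (iter i f (exist _ I0 (conj hI0 nT0)))).1.
have [i] := acc hid
  (fun i => properW (hc i)).
by move=> hi; have [h1 h2] := hc i; exact: h2 hi.
Qed.

Definition ideal_add_span I g : set R := [set x | exists a b, I a /\ x = a + b * g].

Lemma is_ideal_add_span I g : is_ideal I -> is_ideal (ideal_add_span I g).
Proof.
move=> hI; split; first by exists 0, 0; split; [exact: is_ideal0|rewrite mul0r addr0].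
move=> a _ _ [u [v [Iu ->]]] [u' [v' [Iu' ->]]].
exists (a * u + u'), (a * v + v'); split; first by apply: hI.2.
by rewrite mulrDr mulrDl mulrA addrACA.
Qed.

Lemma proper_ideal_add_span I g : is_ideal I -> ~ I g -> I `<` ideal_add_span I g.
Proof.
move=> hI Ig; split.
  by move=> x Ix; exists x, 0; rewrite mul0r addr0.
move=> /(_ g) h; apply: Ig; apply: h; exists 0, 1; rewrite add0r mul1r.
by split=> //; exact: is_ideal0.
Qed.

(** Components are indexed by [nat] below a bound, so that concatenating, merging and deleting them
    is index arithmetic. *)
Definition has_primary_decomposition J n : Prop := exists q : nat -> set R,
  (forall i, (i < n)%N -> primary_ideal (q i)) /\
  (forall x, J x <-> forall i, (i < n)%N -> q i x).

Lemma has_primary_decompositionI J I I' n n' : (forall x, J x <-> I x /\ I' x) ->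
  has_primary_decomposition I n -> has_primary_decomposition I' n' ->
  has_primary_decomposition J (n + n').
Proof.
move=> hJ [q [hq hI]] [q' [hq' hI']].
exists (fun i => if (i < n)%N then q i else q' (i - n)%N); split=> [i ilt|x].
  case: ltnP => hi; first exact: hq.
  by apply: hq'; rewrite ltn_subLR.
rewrite hJ; split=> [[Ix I'x] i ilt|h].
  case: ltnP => hi; first exact: (hI x).1.
  by apply: (hI' x).1 => //; rewrite ltn_subLR.
split; first by apply/hI => i hi; have := h i; rewrite hi; apply; rewrite ltn_addr.
apply/hI' => i hi; have := h (n + i)%N.
by rewrite ltn_add2l (ltnNge (n + i)) leq_addr addKn; apply.
Qed.

(** Noetherian induction. If f g is in J while f and all powers of g are not, the chain J : g^n
    becomes stationary, and then J is the intersection of J + (f) and J + (g^n), both strictly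
    larger. *)
Lemma primary_decomposition J : is_ideal J -> exists n, has_primary_decomposition J n.
Proof.
move: J; apply: (@noetherian_ind (fun J => exists n, has_primary_decomposition J n)).
move=> J hJ ih.
have [J1|nJ1] := pselect (J 1).
  exists 0%N, (fun _ => J); split=> // x; split=> // _.
  by rewrite -[x]mulr1; apply: is_idealMl.
have [hprim|] := pselect (forall f g, J (f * g) -> J f \/ radical J g).
  exists 1%N, (fun _ => J); split=> // x; split=> // h; exact: (h 0%N).
move/existsNP => [f /existsNP [g /not_implyP [Jfg /not_orP [nf ng]]]].
pose c n : set R := [set x | J (g ^+ n * x)].
have [n hn] : exists n, c n.+1 `<=` c n.
  apply: acc => n; last first.
    by move=> x; rewrite /c /= exprS -mulrA; apply: is_idealMl.
  split=> [|a u v]; first by rewrite /c /= mulr0; apply: is_ideal0.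
  by rewrite /c /= mulrDr mulrCA; apply: hJ.2.
have ngn : ~ J (g ^+ n) by move=> h; apply: ng; exists n.
have [n1 h1] := ih _ (is_ideal_add_span f hJ) (proper_ideal_add_span hJ nf).
have [n2 h2] := ih _ (is_ideal_add_span (g ^+ n) hJ) (proper_ideal_add_span hJ ngn).
exists (n1 + n2)%N; apply: has_primary_decompositionI h1 h2 => x; split.
  by move=> Jx; split; exists x, 0; rewrite mul0r addr0.
(* The first expression shows that g x is in J; by the second, b' is then in J : g^(n+1), which is
   contained in J : g^n. *)
move=> [[a [b [Ja ->]]] [a' [b' [Ja' e]]]]; rewrite e.
apply: is_idealD => //; rewrite mulrC; apply: hn; rewrite /c /= exprS -mulrA.
have -> : g * (g ^+ n * b') = g * (a' + b' * g ^+ n) - g * a'.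
  by rewrite mulrDr [_ + g * _]addrC addrK [b' * _]mulrC.
apply: is_idealB => //; last exact: is_idealMl.
rewrite -e mulrDr; apply: is_idealD => //; first exact: is_idealMl.
by rewrite mulrC -mulrA; apply: is_idealMl.
Qed.

Lemma primary_idealI q q' : primary_ideal q -> primary_ideal q' ->
  radical q = radical q' -> primary_ideal (q `&` q').
Proof.
move=> [hq q1 hp] [hq' q1' hp'] e.
have radI g : radical q g -> radical (q `&` q') g.
  move=> rg; have [n hn] := rg; move: rg; rewrite e => -[n' hn'].
  exists (n + n')%N; rewrite exprD; split; first exact: is_idealMr.
  exact: is_idealMl.
split; [split | by case | ].
- by split; exact: is_ideal0.
- by move=> a u v [? ?] [? ?]; split; [apply: hq.2|apply: hq'.2].
move=> f g [/hp [qf|rg] /hp' [qf'|rg']]; [by left| | |]; right; apply: radI => //.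
by rewrite e.
Qed.

(** The length is taken minimal: two components with equal radicals could be merged by intersecting
    them, and a redundant one dropped. [bump] and [unbump] renumber the remaining ones. *)
Lemma exists_irredundant_primary_decomposition J : is_ideal J ->
  exists n (q : 'I_n -> set R), irredundant_primary_decomposition J q.
Proof.
move=> hJ; have [n0 hn0] := primary_decomposition hJ.
have hex : exists n, `[< has_primary_decomposition J n >] by exists n0; apply/asboolP.
case: (ex_minnP hex) => n /asboolP[q [hq hJq]] hmin {n0 hn0 hex}.
have Jq : J = \bigcap_(i : 'I_n) q i.
  apply/seteqP; split=> x; first by move=> /hJq h i _; apply: h.
  by move=> h; apply/hJq => i ilt; apply: (h (Ordinal ilt)).
exists n, (fun i => q i).
have absurd_short (j : 'I_n) : has_primary_decomposition J n.-1 -> False.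
  move=> h; have /hmin := introT (asboolP _) h.
  by have := ltn_ord j; lia.
have hbump (j : 'I_n) i : (i < n.-1)%N -> (bump j i < n)%N.
  case: (n) j => [[]//|m] j /= ilt; exact: (ltn_ord (lift j (Ordinal ilt))).
have hunbump (j : 'I_n) (i : nat) : (i < n)%N -> i != j ->
    exists2 i', (i' < n.-1)%N & i = bump j i'.
  move=> ilt ne; exists (unbump j i); last by rewrite unbumpKcond (negPf ne).
  rewrite /unbump; case: (n) j ilt ne => [//|m] j /= ilt ne.
  by move: (ltn_ord j) ilt ne; case: ltngtP => //= *; lia.
split=> //.
- by move=> i; apply: hq.
- move=> i j e; apply/eqP/negPn/negP => ne; apply: (@absurd_short j).
  exists (fun l => if bump j l == i then q i `&` q j else q (bump j l)).
  split=> [l hl|x].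
    case: eqP => _; last by apply: hq; apply: hbump.
    by apply: primary_idealI => //; apply: hq.
  rewrite hJq; split=> [h l hl|h l hl].
    by case: eqP => _; [split; apply: h|apply: h; exact: hbump].
  have [i' i'lt ei] := hunbump j i (ltn_ord i) ne.
  have := h i' i'lt; rewrite -ei eqxx => -[qi qj].
  have [/eqP->//|nelj] := boolP (l == j :> nat).
  have [l' l'lt el] := hunbump j l hl nelj.
  by have := h l' l'lt; rewrite -el; case: (l =P i :> nat) => [->|].
move=> j hsub; apply: (@absurd_short j); exists (fun l => q (bump j l)).
split=> [l hl|x]; first by apply: hq; apply: hbump.
rewrite hJq; split=> [h l hl|h l hl]; first by apply: h; apply: hbump.
have hx (l' : 'I_n) : l' != j -> q l' x.
  move=> ne; have [l1 h1 ->] := hunbump j l' (ltn_ord l') ne; exact: h.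
have [/eqP->|nelj] := boolP (l == j :> nat); last exact: (hx (Ordinal hl)).
by apply: hsub => l' /= ne; apply: hx.
Qed.

End LaskerNoether.

Section MinimalComponents.
Variable R : comNzRingType.
Implicit Types (I J P q : set R).

Lemma primary_radical_prime q : primary_ideal q -> prime_ideal (radical q).
Proof.
move=> [hq q1 hp]; apply: prime_ideal_intro.
- split=> [|a u v [n hn] [m hm]]; first by exists 1%N; rewrite expr1; exact: is_ideal0.
  exists (n + m)%N; rewrite exprDn; apply: is_ideal_sum => // i _.
  rewrite -mulr_natl; apply: is_idealMl => //.
  have [hi|hi] := leqP m i.
    by apply: is_idealMl => //; rewrite -(subnK hi) exprD; apply: is_idealMl.
  apply: is_idealMr => //; rewrite exprMn; apply: is_idealMl => //.
  have /subnK <- : (n <= n + m - i)%N by lia.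
  by rewrite exprD; apply: is_idealMl.
- by move=> [n]; rewrite expr1n.
move=> u v [n]; rewrite exprMn => /hp[h|[m h]]; first by left; exists n.
by right; exists (n * m)%N; rewrite exprM.
Qed.

Lemma radical_sub q P : prime_ideal P -> q `<=` P -> radical q `<=` P.
Proof. by move=> hP h x [n /h/(prime_idealX hP)]. Qed.

Lemma sub_radical q : q `<=` radical q.
Proof. by move=> x h; exists 1%N; rewrite expr1. Qed.

Lemma prime_bigcap_sub P n (q : 'I_n -> set R) : prime_ideal P ->
  (forall i, is_ideal (q i)) -> \bigcap_i q i `<=` P -> exists i, q i `<=` P.
Proof.
move=> hP hq hsub; apply: contrapT => hno.
have /choice [f hf] (i : 'I_n) : exists x, q i x /\ ~ P x.
  by apply: contrapT => h; apply: hno; exists i => x qx; apply: contrapT => nP;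
     apply: h; exists x.
have : P (\prod_i f i).
  apply: hsub => i _; rewrite (bigD1 i) //=; apply: is_idealMr => //.
  by have [] := hf i.
elim/big_rec: _ => [|i x _ ih /(prime_idealM hP)[|//]]; first exact: prime_ideal1.
by have [] := hf i.
Qed.

Lemma minimal_prime_radical J P n (q : 'I_n -> set R) : minimal_prime J P ->
  irredundant_primary_decomposition J q -> exists i, radical (q i) = P.
Proof.
move=> [hP hJP hmin] [hq hJ _ _].
have [i hi] : exists i, q i `<=` P.
  by apply: prime_bigcap_sub => //; [move=> i; have [] := hq i|rewrite -hJ].
exists i; apply: hmin; first exact: primary_radical_prime.
  move=> x; rewrite hJ => /(_ i Logic.I); exact: sub_radical.
exact: radical_sub.
Qed.

End MinimalComponents.

(** * The ascending chain condition for polynomial rings *)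

Lemma nondecreasing_subsequence (f : nat -> nat) :
  exists2 u : nat -> nat, {homo u : i j / (i < j)%N} & {homo f \o u : i j / (i <= j)%N}.
Proof.
(* [c N] is an index from N on where f takes its least value on that tail, so iterating it gives a
   nondecreasing subsequence. *)
have /choice [c hc] (N : nat) : exists i, (N <= i)%N /\ forall j, (i <= j)%N -> (f i <= f j)%N.
  have hex : exists v, `[< exists2 i, (N <= i)%N & f i = v >].
    by exists (f N); apply/asboolP; exists N.
  case: (ex_minnP hex) => v /asboolP [i hi hv] hmin; exists i; split=> // j hj.
  rewrite hv; apply: hmin; apply/asboolP; exists j => //; exact: leq_trans hj.
pose u := fix u i := if i is i'.+1 then c (u i').+1 else c 0%N.
have hu i : (u i < u i.+1)%N by rewrite /= (hc _).1.
exists u; first by apply: homo_ltn => // ? ? ?; exact: ltn_trans.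
have hf i : (f (u i) <= f (u i.+1))%N.
  have hcu j : exists N, u j = c N by case: j => [|j]; [exists 0%N|exists (u j).+1].
  by have [N e] := hcu i; rewrite [u i]e; apply: (hc _).2; rewrite -e ltnW.
by apply: homo_leq => // ? ? ?; exact: leq_trans.
Qed.

(** Subsequences are extracted one coordinate at a time; [m] counts the coordinates made
    nondecreasing so far. *)
Lemma dickson n (g : nat -> 'X_{1..n}) : exists i j, (i < j)%N /\ (g i <= g j)%MM.
Proof.
have : forall m, exists2 u : nat -> nat, {homo u : i j / (i < j)%N} &
    forall i j (t : 'I_n), (t < m)%N -> (i <= j)%N -> (g (u i) t <= g (u j) t)%N.
  elim=> [|m [u hu hg]]; first by exists id.
  have [mn|nm] := ltnP m n; last first.
    by exists u => // i j t _; apply: hg; exact: leq_trans nm.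
  have [v hv hgv] := nondecreasing_subsequence (fun i => g (u i) (Ordinal mn)).
  exists (u \o v) => [i j ij|i j t]; first by apply: hu; apply: hv.
  rewrite ltnS leq_eqVlt => /orP[/eqP tm|tm] ij.
    have -> : t = Ordinal mn by exact: val_inj.
    exact: hgv.
  by apply: hg => //; apply: (ltnW_homo hv).
move=> /(_ n) [u hu hg]; exists (u 0%N), (u 1%N); split; first exact: hu.
by apply/mnm_lepP => t; apply: hg.
Qed.

(** Each f_i in I_(i+1) outside I_i is chosen with minimal leading monomial. By [dickson] the
    leading monomial of some f_i divides that of f_j with i < j, and cancelling it leaves an element
    of I_(j+1) outside I_j with a smaller leading monomial. *)
Lemma mpoly_acc (k : fieldType) n (I : nat -> set {mpoly k[n]}) :
  (forall i, is_ideal (I i)) -> (forall i, I i `<=` I i.+1) -> exists i, I i.+1 `<=` I i.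
Proof.
move=> hI hS; apply: contrapT => hno.
have hmono i j : (i <= j)%N -> I i `<=` I j.
  move=> /subnK <-; elim: (j - i)%N => // m ih x /ih; exact: hS.
have /choice [f hf] i : exists f, [/\ I i.+1 f, ~ I i f &
    forall g, I i.+1 g -> ~ I i g -> ~~ (mlead g < mlead f)%O].
  have [f [h1 h2]] : exists f, I i.+1 f /\ ~ I i f.
    apply: contrapT => h; apply: hno; exists i => x hx; apply: contrapT => nx.
    by apply: h; exists x.
  elim/(well_founded_ind (@ltom_wf n)): {f}(mlead f) {-2}f (erefl (mlead f)) h1 h2 => m ih f hm h1 h2.
  have [[g [hg1 hg2 hg3]]|h] := pselect (exists g, [/\ I i.+1 g, ~ I i g & (mlead g < m)%O]).
    exact: (ih _ hg3 g).
  by exists f; split=> // g hg1 hg2; apply/negP; rewrite hm => hg3; apply: h; exists g.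
have [i [j [ij hlt]]] := dickson (fun i => mlead (f i)).
have [hi1 hi2 _] := hf i; have [hj1 hj2 hj3] := hf j.
have fi0 : f i != 0 by apply/eqP => e; apply: hi2; rewrite e; apply: is_ideal0.
set li := mlead (f i) in hlt; set lj := mlead (f j) in hlt.
pose h := ((f j)@_lj / (f i)@_li) *: 'X_[lj - li] * f i.
have Ih : I j h by apply: is_idealMl => //; apply: hmono hi1.
have nI : ~ I j (f j - h).
  by move=> hh; apply: hj2; rewrite -[f j](subrK h); apply: is_idealD.
have := hj3 (f j - h); rewrite (_ : I j.+1 _ = True) ?propeqE; last first.
  by split=> // _; apply: is_idealB => //; apply: hS.
move=> /(_ Logic.I nI) /negP; apply.
have g0 : f j - h != 0 by apply/eqP => e; apply: nI; rewrite e; apply: is_ideal0.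
have c0 : (f i)@_li != 0 by rewrite mleadc_eq0.
have fj0 : f j != 0 by apply/eqP => e; apply: hj2; rewrite e; apply: is_ideal0.
have cj : (f j)@_lj / (f i)@_li != 0 by rewrite mulf_neq0 ?invr_eq0 // mleadc_eq0.
have lh : mlead h = lj.
  rewrite /h -scalerAl mleadZ // mleadM ?mleadXm ?submK //.
  by rewrite -msize_poly_eq0 msizeX.
have hc : h@_lj = (f j)@_lj.
  have := mcoeffMX (f i) (lj - li) li; rewrite submK // mulrC => e.
  by rewrite /h -scalerAl mcoeffZ e mulfVK.
rewrite lt_neqAle; apply/andP; split.
  apply/eqP => e; have : (f j - h)@_(mlead (f j - h)) != 0 by rewrite mleadc_eq0.
  by rewrite e mcoeffB hc subrr eqxx.
by have := mleadB_le (f j) h; rewrite lh joinxx.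
Qed.

(** * The gradient of a determinant and Hankel matrices *)

Lemma mderiv_prod (R : comNzRingType) n (t : 'I_n) (I : finType) (F : I -> {mpoly R[n]}) :
  (\prod_i F i)^`M(t) = \sum_i (F i)^`M(t) * \prod_(j | j != i) F j.
Proof.
suff h (r : seq I) : uniq r ->
    (\prod_(i <- r) F i)^`M(t) = \sum_(i <- r) (F i)^`M(t) * \prod_(j <- r | j != i) F j.
  by apply: h; exact: index_enum_uniq.
elim: r => [|a r ih] /=; first by rewrite !big_nil -[1]mpolyC1 mderivC.
case/andP => ar ur; rewrite !big_cons mderivM ih // eqxx; congr (_ + _).
  congr (_ * _); rewrite big_seq [RHS]big_seq_cond; apply: eq_bigl => j.
  by case jr: (j \in r) => //=; apply/esym/eqP => e; move: ar; rewrite -e jr.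
rewrite mulr_sumr; apply: eq_big_seq => j jr; rewrite big_cons.
have -> : a != j by apply/eqP => e; rewrite -e (negPf ar) in jr.
by rewrite mulrCA.
Qed.

Lemma mderiv_det (R : comNzRingType) n (t : 'I_n) m (A : 'M[{mpoly R[n]}]_m) :
  (\det A)^`M(t) = \sum_i \sum_j (A i j)^`M(t) * cofactor A i j.
Proof.
pose B i := \matrix_(a, b) if a == i then (A a b)^`M(t) else A a b.
transitivity (\sum_i \det (B i)).
  rewrite raddf_sum exchange_big /=; apply: eq_bigr => s _.
  have hs (b : bool) (p : {mpoly R[n]}) : ((-1) ^+ b * p)^`M(t) = (-1) ^+ b * p^`M(t).
    by case: b; rewrite ?expr1 ?expr0 ?mulN1r ?mul1r ?mderivN.
  rewrite hs mderiv_prod mulr_sumr; apply: eq_bigr => i _; congr (_ * _).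
  rewrite [RHS](bigD1 i) //= mxE eqxx; congr (_ * _).
  by apply: eq_bigr => j ji; rewrite mxE (negPf ji).
apply: eq_bigr => i _; rewrite (expand_det_row (B i) i); apply: eq_bigr => j _.
rewrite mxE eqxx /cofactor; congr (_ * (_ * \det _)).
by apply/matrixP => a b; rewrite !mxE eq_sym (negPf (neq_lift _ _)).
Qed.

Lemma rank1_minor (K : fieldType) m (A : 'M[K]_m) i j p q : (\rank A <= 1)%N ->
  A i j * A p q = A i q * A p j.
Proof.
move=> hr; rewrite -(mulmx_base A); move: (col_base A) (row_base A).
case: (\rank A) hr => [|[|//]] _ B C; rewrite !mxE ?big_ord0 ?mul0r //.
by rewrite !big_ord1; ring.
Qed.

Lemma mxrank_mxsub_le (K : fieldType) m n m' n' (f : 'I_m' -> 'I_m) (g : 'I_n' -> 'I_n)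
  (A : 'M[K]_(m, n)) : (\rank (mxsub f g A) <= \rank A)%N.
Proof.
have -> : mxsub f g A = rowsub f (colsub g A) by apply/matrixP => i j; rewrite !mxE.
apply: leq_trans (mxrankS (rowsub_sub _ _)) _.
by rewrite -mxrank_tr trmx_mxsub -[\rank A]mxrank_tr; apply: mxrankS; exact: rowsub_sub.
Qed.

Lemma det_mxsub_neq0 (K : fieldType) m n t (f : 'I_t -> 'I_m) (g : 'I_t -> 'I_n)
  (A : 'M[K]_(m, n)) : \det (mxsub f g A) != 0 -> (t <= \rank A)%N.
Proof.
move=> h; have /mxrank_unit <- : mxsub f g A \in unitmx by rewrite unitmxE unitfE.
exact: mxrank_mxsub_le.
Qed.

Section HankelKernel.
Variables (K : fieldType) (m N : nat) (y : nat -> K).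
Let H : 'M[K]_m := \matrix_(i, j) y (i + j)%N.

(* If the rank is [m - 1], the adjugate is a multiple of [v v^T] with [v] spanning the
   kernel; the antidiagonal sums of [v v^T] are the coefficients of [(\sum_i v_i z^i)^2]. *)
Lemma hankel_gradient_eq0 : (forall t, (N <= t)%N -> y t = 0) -> \det H = 0 ->
  (forall t, (t < N)%N -> \sum_(i < m) \sum_(j < m | (i + j)%N == t) cofactor H i j = 0) ->
  (exists i j, cofactor H i j != 0) -> forall t, (m.-1 <= t)%N -> y t = 0.
Proof.
move=> hN hdet hgrad [p [q hpq]].
have Hsym : H^T = H by apply/matrixP => i j; rewrite !mxE addnC.
have csym i j : cofactor H i j = cofactor H j i by rewrite -{1}Hsym cofactor_tr.
have hrk : (\rank (\adj H) <= 1)%N.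
  have h1 : (\rank H + \rank (\adj H) <= m)%N.
    by apply: mulmx0_rank_max; rewrite mul_mx_adj hdet raddf0.
  have : (m.-1 <= \rank H)%N.
    apply: (@det_mxsub_neq0 _ _ _ _ (lift p) (lift q)).
    move: hpq; rewrite mulf_eq0 => /norP[_]; congr (\det _ != 0).
    by apply/matrixP => i j; rewrite !mxE.
  by have := ltn_ord p; lia.
have hC i j a b : cofactor H i j * cofactor H a b = cofactor H i b * cofactor H a j.
  have := rank1_minor j i b a hrk; rewrite !mxE => ->.
  by rewrite mulrC.
(* Row p of the symmetric rank-one matrix of cofactors serves as v; its entry c at q is nonzero, and
   the entry at (q, q) fixes the factor [la]. *)
set c := cofactor H p q in hpq; pose v i := cofactor H p i.
pose la := cofactor H q q / c ^+ 2.
have cofM i j : cofactor H i j = la * (v i * v j).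
  have -> : la * (v i * v j) = cofactor H q q * v i * v j / c ^+ 2 by rewrite /la; field.
  apply: (canRL (mulfK (expf_neq0 2 hpq))).
  have e1 := hC i j p q; have e2 := hC q i p q; rewrite -/c in e1 e2.
  transitivity ((cofactor H i j * c) * c); first by ring.
  transitivity ((cofactor H q i * c) * cofactor H p j); last by rewrite e2.
  by rewrite e1 (csym i q); ring.
have la0 : la != 0.
  by apply: contraNneq hpq => la0; rewrite /c cofM la0 mul0r.
have hv t : (t < N)%N -> \sum_(i < m) \sum_(j < m | (i + j)%N == t) v i * v j = 0.
  move=> /hgrad h; apply: (mulfI la0); rewrite mulr0 -[RHS]h mulr_sumr.
  apply: eq_bigr => i _; rewrite mulr_sumr; apply: eq_bigr => j _; exact/esym.
have hker (i : 'I_m) : \sum_(j < m) y (i + j)%N * v j = 0.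
  have := mul_mx_adj H; rewrite hdet raddf0 => /matrixP/(_ i p); rewrite !mxE => h.
  by rewrite -[RHS]h; apply: eq_bigr => j _; rewrite !mxE.
pose V j := if insub j is Some i then v (i : 'I_m) else 0.
have hex : exists j, V j != 0 by exists q; rewrite /V valK.
case: (ex_minnP hex) => j0; rewrite {1}/V; case: insubP => [i0 _ i0j0 vi0 hmin|]; last first.
  by rewrite eqxx.
have vlt (j : 'I_m) : (j < j0)%N -> v j = 0.
  move=> jlt; apply: contraTeq jlt => vj; rewrite -leqNgt; apply: hmin.
  by rewrite /V valK.
(* The coefficient of z^(2 j0) in v(z)^2 is the square of the first nonzero entry of v. *)
have j0N : (N <= j0.*2)%N.
  rewrite leqNgt; apply/negP => /hv/eqP; rewrite (bigD1 i0) //= (bigD1 i0) /=; last first.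
    by rewrite i0j0 addnn.
  rewrite big1 ?addr0 => [|j /andP[/eqP e ne]]; last first.
    by move/eqP: ne => []; apply: val_inj; move: e; rewrite /= i0j0 -addnn => /addnI.
  rewrite big1 ?addr0 => [|i ne]; first by rewrite mulf_eq0 (negPf vi0).
  rewrite big1 // => j /eqP e; have [/vlt->|ile] := ltnP i j0; first by rewrite mul0r.
  rewrite [v j]vlt ?mulr0 //; have ne' : i != j0 :> nat.
    by apply: contraNneq ne => ij0; apply/eqP/val_inj; rewrite /= ij0 i0j0.
  by move: e ile ne'; lia.
suff h t : (j0 <= t)%N -> y t = 0.
  by move=> t ht; apply: h; have := ltn_ord i0; move: i0j0 ht j0N => /= <-; lia.
(* Descending induction on t. In row t - j0 of H v = 0 the term at j0 is y_t v_(j0); earlier terms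
   vanish with v, and later ones involve y beyond t. *)
have [d] := ubnP (N - t); elim: d t => // d ih t ht jt.
have [/hN//|tN] := leqP N t.
have im : (t - j0 < m)%N by have := ltn_ord i0; move: i0j0 tN jt j0N => /= <-; lia.
have /eqP := hker (Ordinal im); rewrite (bigD1 i0) //= big1 => [|j ne].
  by rewrite addr0 i0j0 subnK // mulf_eq0 (negPf vi0) orbF => /eqP.
have [/vlt->|jle] := ltnP j j0; first by rewrite mulr0.
rewrite ih ?mul0r //; last by lia.
have ne' : j != j0 :> nat.
  by apply: contraNneq ne => ij0; apply/eqP/val_inj; rewrite /= ij0 i0j0.
by move: jle ne' ht jt tN; lia.
Qed.

End HankelKernel.

(** * Minors of tridiagonal Toeplitz matrices *)

Section Tridiagonal.
Variable R : comNzRingType.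

(** Entries are functions on [nat], so blocks and deleted rows or columns become index shifts
    without casts between ordinals. *)
Definition detF n (F : nat -> nat -> R) := \det (\matrix_(i < n, j < n) F i j).

Lemma eq_detF n F G : (forall i j, (i < n)%N -> (j < n)%N -> F i j = G i j) ->
  detF n F = detF n G.
Proof. by move=> h; congr (\det _); apply/matrixP => i j; rewrite !mxE h. Qed.

Lemma detF_tr n F : detF n (fun i j => F j i) = detF n F.
Proof. by rewrite /detF -det_tr; congr (\det _); apply/matrixP => i j; rewrite !mxE. Qed.

Lemma detF0 F : detF 0 F = 1. Proof. exact: det_mx00. Qed.

Lemma detF1 F : detF 1 F = F 0%N 0%N. Proof. by rewrite /detF det_mx11 mxE. Qed.

Lemma detF_ublock p n F : (forall i j, (p <= i)%N -> (j < p)%N -> F i j = 0) ->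
  detF (p + n) F = detF p F * detF n (fun i j => F (p + i)%N (p + j)%N).
Proof.
move=> h; rewrite /detF -(det_ublock _ (\matrix_(i < p, j < n) F i (p + j)%N)).
congr (\det _); apply/matrixP => i j; rewrite mxE.
case: (splitP i) => i' ei; case: (splitP j) => j' ej; rewrite ?ei ?ej.
- have -> : i = lshift n i' by exact: val_inj.
  by have -> : j = lshift n j' by [exact: val_inj]; rewrite block_mxEul mxE.
- have -> : i = lshift n i' by exact: val_inj.
  by have -> : j = rshift p j' by [exact: val_inj]; rewrite block_mxEur mxE.
- have -> : i = rshift p i' by exact: val_inj.
  have -> : j = lshift n j' by exact: val_inj.
  by rewrite block_mxEdl mxE h ?leq_addr.
- have -> : i = rshift p i' by exact: val_inj.
  by have -> : j = rshift p j' by [exact: val_inj]; rewrite block_mxEdr mxE.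
Qed.

Lemma detF_lblock p n F : (forall i j, (i < p)%N -> (p <= j)%N -> F i j = 0) ->
  detF (p + n) F = detF p F * detF n (fun i j => F (p + i)%N (p + j)%N).
Proof.
move=> h; rewrite -detF_tr detF_ublock; last by move=> i j ? ?; apply: h.
by rewrite detF_tr (detF_tr n (fun i j => F (p + i)%N (p + j)%N)).
Qed.

Lemma detF_utri n F c : (forall i j, (j < i)%N -> F i j = 0) -> (forall i, F i i = c) ->
  detF n F = c ^+ n.
Proof.
elim: n F => [|n ih] F h hc; first by rewrite detF0.
rewrite -add1n detF_ublock; last by move=> i [|//] hi _; apply: h.
by rewrite detF1 hc ih ?exprS // => i j hij; apply: h.
Qed.

Definition tri (a b c : R) (i j : nat) : R :=
  if i == j then b else if i == j.+1 then c else if i.+1 == j then a else 0.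

Lemma tri_tr a b c i j : tri a b c j i = tri c b a i j.
Proof.
by rewrite /tri; do !case: eqP => //= ?; exfalso; lia.
Qed.

Lemma triDD a b c p i j : tri a b c (p + i) (p + j) = tri a b c i j.
Proof. by rewrite /tri -!addnS !eqn_add2l. Qed.

(** A continuant with constant coefficients: up to scaling, a Chebyshev polynomial of the second
    kind. *)
Definition theta a b c n := detF n (tri a b c).

Lemma theta_swap a b c n : theta a b c n = theta c b a n.
Proof. by rewrite /theta -detF_tr; apply: eq_detF => i j _ _; rewrite tri_tr. Qed.

Lemma theta0 a b c : theta a b c 0 = 1. Proof. exact: detF0. Qed.

Lemma theta1 a b c : theta a b c 1 = b. Proof. by rewrite /theta detF1. Qed.

Lemma theta_rec a b c n :
  theta a b c n.+2 = b * theta a b c n.+1 - a * c * theta a b c n.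
Proof.
rewrite {1}/theta /detF (expand_det_col _ ord0) !big_ord_recl big1 => [|i _]; last first.
  by rewrite mxE /= mul0r.
rewrite !mxE /= addr0 /cofactor /= expr0 expr1 mul1r mulN1r mulrN.
congr (b * _ - _); first by congr (\det _); apply/matrixP => i j; rewrite !mxE /= (triDD _ _ _ 1).
pose G i j := tri a b c (bump 1 i) j.+1.
have -> : a * c * theta a b c n = c * detF n.+1 G.
  rewrite -add1n detF_lblock => [|[|//] j _]; last by case: j.
  have -> : detF n (fun i j => G (1 + i)%N (1 + j)%N) = theta a b c n.
    by apply: eq_detF => i j _ _; rewrite /G /bump /= !add1n; exact: (triDD _ _ _ 2).
  by rewrite detF1 /G /tri /=; ring.
by congr (_ * \det _); apply/matrixP => i j; rewrite !mxE.
Qed.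

(** A Cassini-type identity: applying the recurrence inside both products multiplies the difference
    by a c when j grows by one. *)
Lemma theta_mul a b c j l : theta a b c j.+1 * theta a b c (j + l).+1 -
  theta a b c j * theta a b c (j + l).+2 = (a * c) ^+ j.+1 * theta a b c l.
Proof.
elim: j => [|j ih]; first by rewrite theta1 theta0 !add0n theta_rec expr1; ring.
by rewrite [in RHS]exprS -mulrA -ih !addSn [theta a b c (j + l).+3]theta_rec
  [theta a b c j.+2]theta_rec; ring.
Qed.

(** Deleting row p and column q leaves a block triangular matrix: tridiagonal blocks of sizes p and
    n - q, and between them a triangular block of size q - p whose diagonal is the old subdiagonal
    c. *)
Lemma tri_minor a b c p q n : (p <= q <= n)%N ->
  detF n (fun i j => tri a b c (bump p i) (bump q j)) =
  theta a b c p * c ^+ (q - p) * theta a b c (n - q).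
Proof.
case/andP => pq qn; rewrite -{1}(subnKC (leq_trans pq qn)) detF_ublock => [|i j hi hj].
  rewrite -(subnKC (leq_sub2r p qn)) detF_ublock => [|i j hi hj].
    rewrite mulrA; congr (_ * _ * _).
    - by apply: eq_detF => i j hi hj; rewrite /bump [(p <= i)%N]leqNgt [(q <= j)%N]leqNgt hi (leq_trans hj pq).
    - have hd : detF (q - p) (fun i j => tri a b c i.+1 j) = c ^+ (q - p).
        apply: detF_utri => [i j|i]; rewrite /tri; first by do !case: eqP => //= ?; lia.
        by rewrite eqxx; case: eqP => // ?; lia.
      rewrite -{}hd; apply: eq_detF => i j hi hj; rewrite /bump.
      have -> : (p <= p + i)%N by lia.
      have -> : (q <= p + j)%N = false by lia.
      by rewrite add1n add0n -addnS triDD.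
    - have -> : (n - p - (q - p) = n - q)%N by lia.
      apply: eq_detF => i j hi hj; rewrite /bump.
      have -> : (p <= p + (q - p + i))%N by lia.
      have -> : (q <= p + (q - p + j))%N by lia.
      by rewrite -(triDD a b c q.+1 i); congr (tri _ _ _ _ _); rewrite add1n; lia.
  rewrite /tri /bump; have -> : (p <= p + i)%N by lia.
  have -> : (q <= p + j)%N = false by lia.
  by do !case: eqP => //= ?; lia.
rewrite /tri /bump; have -> : (p <= i)%N by lia.
have -> : (q <= j)%N = false by lia.
by do !case: eqP => //= ?; lia.
Qed.

(* The differences [theta_mul] of the products [e^i theta_j theta_l], [e = a] or [c],
   yield the monomials [e^i (ac)^j b^l]. *)
Lemma theta_span (W : R -> Prop) a b c e n :
  (forall x y, W x -> W y -> W (x - y)) ->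
  (forall i j l, (i + j + l = n)%N -> W (e ^+ i * (theta a b c j * theta a b c l))) ->
  forall i j l, (i + j.*2 + l = n)%N -> W (e ^+ i * (a * c) ^+ j * b ^+ l).
Proof.
move=> WB hW.
have W0 : W 0.
  by rewrite -(subrr (e ^+ n * (theta a b c 0 * theta a b c 0))); apply: (WB); apply: hW;
    rewrite !addn0.
have WD x y : W x -> W y -> W (x + y).
  by move=> wx wy; rewrite -[y]opprK -[- y]sub0r; apply: (WB) => //; apply: (WB).
have h1 i j l : (i + j.*2 + l = n)%N -> W (e ^+ i * (a * c) ^+ j * theta a b c l).
  case: j => [|j] hn.
    by rewrite expr0 mulr1 -[theta a b c l]mul1r -(theta0 a b c); apply: hW; lia.
  by rewrite -mulrA -theta_mul mulrBr; apply: WB; apply: hW; lia.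
(* The recurrence in the form b theta_(l+1) = theta_(l+2) + a c theta_l creates the factors b one by
   one. *)
have h2 t : forall i j l, (i + j.*2 + t + l = n)%N ->
    W (e ^+ i * (a * c) ^+ j * b ^+ t * theta a b c l).
  elim: t => [|t ih] i j l hn; first by rewrite expr0 mulr1; apply: h1; lia.
  case: l hn => [|l] hn.
    have -> : e ^+ i * (a * c) ^+ j * b ^+ t.+1 * theta a b c 0 =
      e ^+ i * (a * c) ^+ j * b ^+ t * theta a b c 1 by rewrite theta0 theta1 exprS; ring.
    by apply: ih; lia.
  have -> : e ^+ i * (a * c) ^+ j * b ^+ t.+1 * theta a b c l.+1 =
      e ^+ i * (a * c) ^+ j * b ^+ t * theta a b c l.+2 +
      e ^+ i * (a * c) ^+ j.+1 * b ^+ t * theta a b c l.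
    by rewrite theta_rec !exprS; ring.
  by apply: WD; apply: ih; lia.
by move=> i j l hn; rewrite -[_ * b ^+ l]mulr1 -(theta0 a b c); apply: h2; lia.
Qed.

(** Minors with p <= q supply the products of [theta_span] for e = c, and their transposes those for
    e = a. Which of the two is used depends on whether a or c has the larger exponent. *)
Lemma tri_minors_span (W : R -> Prop) a b c n :
  (forall x y, W x -> W y -> W (x - y)) ->
  (forall p q, (p <= n)%N -> (q <= n)%N ->
     W (detF n (fun i j => tri a b c (bump p i) (bump q j)))) ->
  forall i j l, (i + j + l = n)%N -> W (a ^+ i * b ^+ j * c ^+ l).
Proof.
move=> WB hW.
have hc i j l : (i + j + l = n)%N -> W (c ^+ i * (theta a b c j * theta a b c l)).
  move=> hn; have := hW j (j + i)%N; rewrite tri_minor; last by lia.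
  have -> : (n - (j + i) = l)%N by lia.
  by rewrite addKn -mulrA mulrCA; apply; lia.
have ha i j l : (i + j + l = n)%N -> W (a ^+ i * (theta a b c j * theta a b c l)).
  move=> hn; have := hW (j + i)%N j; rewrite -detF_tr.
  under eq_detF do rewrite tri_tr.
  rewrite tri_minor; last by lia.
  have -> : (n - (j + i) = l)%N by lia.
  by rewrite addKn -mulrA mulrCA !(theta_swap c); apply; lia.
move=> i j l hn; have [li|il] := leqP l i.
  have := theta_span WB ha (i := i - l) (j := l) (l := j).
  rewrite exprMn -(subnK li) exprD addnK; set u := (i - l)%N.
  have -> : a ^+ u * (a ^+ l * c ^+ l) * b ^+ j = a ^+ u * a ^+ l * b ^+ j * c ^+ l by ring.
  by apply; rewrite /u; lia.
have := theta_span WB hc (i := l - i) (j := i) (l := j).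
rewrite exprMn -{3}(subnK (ltnW il)) exprD; set u := (l - i)%N.
have -> : c ^+ u * (a ^+ i * c ^+ i) * b ^+ j = a ^+ i * b ^+ j * (c ^+ u * c ^+ i) by ring.
by apply; rewrite /u; lia.
Qed.

End Tridiagonal.

(** * A partition identity *)

Lemma geometric_sum (R : comNzRingType) (q : R) u :
  (1 - q) * (\sum_(v < u.+1) q ^+ v) = 1 - q ^+ u.+1.
Proof.
elim: u => [|u ih]; first by rewrite big_ord1 expr0 mulr1 expr1.
by rewrite big_ord_recr /= mulrDr ih [in RHS]exprS; ring.
Qed.

Section GaussBinomial.
Variables (R : comNzRingType) (q : R).

Let A u := \sum_(v < u.+1) q ^+ v.
Let B t := \sum_(u < t.+1) q ^+ u * A u.

Let AE u : (1 - q) * A u = 1 - q ^+ u.+1.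
Proof. exact: geometric_sum. Qed.

Let BE t : (1 - q) * (1 - q ^+ 2) * B t = (1 - q ^+ t.+1) * (1 - q ^+ t.+2).
Proof.
rewrite /B; elim: t => [|t ih].
  by rewrite big_ord1 -mulrA [_ * (q ^+ 0 * _)]mulrCA expr0 mul1r mulrCA AE expr1; ring.
rewrite big_ord_recr /= mulrDr ih.
have -> x y : (1 - q) * (1 - q ^+ 2) * (x * A y) = (1 - q ^+ 2) * x * ((1 - q) * A y) by ring.
by rewrite AE !exprS; ring.
Qed.

(** The sum over s >= t >= u >= v is the Gaussian binomial coefficient of s + 3 over 3; likewise
    [A u] is that of u + 1 over 1 and [B t] that of t + 2 over 2. *)
Lemma gauss_binomial3 s :
  (1 - q) * (1 - q ^+ 2) * (1 - q ^+ 3) *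
    (\sum_(t < s.+1) \sum_(u < t.+1) \sum_(v < u.+1) q ^+ (t + u + v)) =
  (1 - q ^+ s.+1) * (1 - q ^+ s.+2) * (1 - q ^+ s.+3).
Proof.
have -> : \sum_(t < s.+1) \sum_(u < t.+1) \sum_(v < u.+1) q ^+ (t + u + v) =
    \sum_(t < s.+1) q ^+ t * B t.
  apply: eq_bigr => t _; rewrite /B mulr_sumr; apply: eq_bigr => u _.
  by rewrite /A mulrA mulr_sumr; apply: eq_bigr => v _; rewrite !exprD.
have h t x : (1 - q) * (1 - q ^+ 2) * (1 - q ^+ 3) * (x * B t) =
  (1 - q ^+ 3) * x * ((1 - q ^+ t.+1) * (1 - q ^+ t.+2)).
  by rewrite -BE; ring.
elim: s => [|s ih]; first by rewrite big_ord1 h expr0 mulr1 expr1; ring.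
by rewrite big_ord_recr /= mulrDr ih h !exprS; ring.
Qed.

End GaussBinomial.

(** The constant term 1 makes d invertible as a power series, so p itself is divisible by
    X^(n+1). *)
Lemma coef_mul_eq0 (R : comNzRingType) (p d r : {poly R}) n : d`_0 = 1 ->
  p * d = 'X^(n.+1)%N * r -> p`_n = 0.
Proof.
move=> d0 e; suff: forall i, (i <= n)%N -> p`_i = 0 by apply.
move=> i; have [j] := ubnP i; elim: j i => // j ih i ij ilen.
have : (p * d)`_i = 0 by rewrite e coefXnM ltnS ilen.
rewrite coefM big_ord_recr /= subnn d0 mulr1 big1 ?add0r // => l _.
by have li := ltn_ord l; rewrite ih ?mul0r //; move: li ij ilen; rewrite /=; lia.
Qed.

(** [g i] is the multiplicity of the part i + 1 in a partition of n into parts at most s;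
    multiplicities never exceed n. *)
Definition partition_ffuns s n :=
  [set g : {ffun 'I_s -> 'I_n.+1} | (\sum_i g i * i.+1)%N == n]%SET.

(** Pairs, of total weight n, of a partition with at most three parts, each at most s, and a
    partition into parts from 4 to s + 3. They index the normal monomials of weight n, up to powers
    of w_0. *)
Definition box_partition_ffuns s n :=
  [set e : ('I_s.+1 * 'I_s.+1 * 'I_s.+1) * {ffun 'I_s -> 'I_n.+1} |
    [&& (e.1.1.2 <= e.1.1.1)%N, (e.1.2 <= e.1.1.2)%N &
      (e.1.1.1 + e.1.1.2 + e.1.2 + \sum_i e.2 i * (i + 4))%N == n]]%SET.

(** Generating functions: the Gaussian binomial coefficient of s + 3 over 3 times the product of
    1/(1 - q^i) for 4 <= i <= s + 3 is the same product for 1 <= i <= s. Geometric series are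
    truncated after n + 1 terms, so the computation is modulo q^(n+1). *)
Lemma card_box_partition_ffuns s n :
  #|box_partition_ffuns s n| = #|partition_ffuns s n|.
Proof.
pose geo w : {poly int} := \sum_(i < n.+1) 'X^(w * i)%N.
pose E : {poly int} := \sum_(t < s.+1) \sum_(u < t.+1) \sum_(v < u.+1) 'X^(t + u + v)%N.
pose gs c : {poly int} := \prod_(i < s) geo (i + c)%N.
have coef_card (T : finType) (P : pred T) (f : T -> nat) :
    (\sum_(x | P x) 'X^(f x)%N : {poly int})`_n = #|[set x | P x && (f x == n)]%SET|%:R.
  rewrite coef_sum -sum1_card natr_sum big_mkcond [RHS]big_mkcond /=.
  by apply: eq_bigr => x _; rewrite inE coefXn eq_sym; case: (P x); case: eqP.
have gsE c : gs c = \sum_(g : {ffun 'I_s -> 'I_n.+1}) 'X^(\sum_i g i * (i + c))%N.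
  rewrite /gs /geo bigA_distr_bigA; apply: eq_bigr => g _.
  by rewrite -expr_sum; congr ('X^_); apply: eq_bigr => i _; rewrite mulnC.
have h1 : (gs 1%N)`_n = #|partition_ffuns s n|%:R.
  rewrite gsE (coef_card _ xpredT); congr (_%:R); apply: eq_card => g.
  by rewrite !inE; congr (_ == _); apply: eq_bigr => i _; rewrite addn1.
have h2 : (E * gs 4)`_n = #|box_partition_ffuns s n|%:R.
  have -> : E * gs 4 = \sum_(e : ('I_s.+1 * 'I_s.+1 * 'I_s.+1) * {ffun 'I_s -> 'I_n.+1} |
      (e.1.1.2 <= e.1.1.1)%N && (e.1.2 <= e.1.1.2)%N)
      'X^(e.1.1.1 + e.1.1.2 + e.1.2 + \sum_i e.2 i * (i + 4))%N.
    transitivity (\sum_(t < s.+1) \sum_(u < s.+1 | (u <= t)%N) \sum_(v < s.+1 | (v <= u)%N)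
       \sum_(g : {ffun 'I_s -> 'I_n.+1}) ('X^(t + u + v + \sum_i g i * (i + 4))%N : {poly int})).
      rewrite mulr_suml; apply: eq_bigr => t _.
      rewrite [RHS](big_ord_narrow_leq (ltn_ord t : (t <= s)%N)) mulr_suml.
      apply: eq_bigr => u _ /=.
      have us : (u <= s)%N by have := ltn_ord u; have := ltn_ord t; lia.
      rewrite [RHS](big_ord_narrow_leq us) mulr_suml; apply: eq_bigr => v _ /=.
      by rewrite gsE mulr_sumr; apply: eq_bigr => g _; rewrite -exprD.
    rewrite pair_big_dep /= pair_big_dep /= pair_big_dep /=.
    by apply: eq_bigl => e; rewrite andbT.
  by rewrite coef_card; congr (_%:R); apply: eq_card => e; rewrite !inE -andbA.
apply/eqP; rewrite -(Num.Theory.eqr_nat int) -h1 -h2 -subr_eq0 -coefB; apply/eqP.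
pose D a c : {poly int} := \prod_(i < a) (1 - 'X^(i + c)%N).
have hg c : (0 < c)%N -> exists r, gs c * D s c = 1 + 'X^(n.+1)%N * r.
  move=> c0; rewrite /gs /D -big_split /=.
  apply: (big_ind (fun p : {poly int} => exists r, p = 1 + 'X^(n.+1)%N * r)).
  - by exists 0; rewrite mulr0 addr0.
  - by move=> _ _ [r ->] [r' ->]; exists (r + r' + 'X^(n.+1)%N * (r * r')); ring.
  move=> i _; exists (- 'X^((i + c).-1 * n.+1)%N).
  rewrite mulrN -exprD -mulSn prednK ?addn_gt0 ?c0 ?orbT // mulrC /geo.
  under eq_bigr do rewrite exprM.
  by rewrite geometric_sum exprM.
have [r1 e1] := hg 1%N isT; have [r4 e4] := hg 4 isT.
have hE : D 3 1%N * E = D 3 s.+1.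
  rewrite /D !big_ord_recr !big_ord0 /= !mul1r !add0n !add1n; exact: gauss_binomial3.
have hD : D s 1%N * D 3 s.+1 = D 3 1%N * D s 4.
  transitivity (D (s + 3)%N 1%N).
    rewrite /D [RHS]big_split_ord /=; congr (_ * _); apply: eq_bigr => i _.
    by rewrite addn1 addnS addnC.
  rewrite [(s + 3)%N]addnC /D [LHS]big_split_ord /=; congr (_ * _); apply: eq_bigr => i _.
  by rewrite addn1 addnC !addnS.
apply: (@coef_mul_eq0 _ _ (D s 1%N * D 3 s.+1) ((r4 - r1) * D 3 s.+1)).
  by rewrite -horner_coef0 hornerM /D !horner_prod !big1 ?mulr1 // => i _;
    rewrite !hornerE expr0n addnS subr0.
rewrite mulrBl {1}hD.
have -> : gs 1%N * (D s 1%N * D 3 s.+1) = (gs 1%N * D s 1%N) * D 3 s.+1 by rewrite mulrA.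
have -> : E * gs 4 * (D 3 1%N * D s 4) = (D 3 1%N * E) * (gs 4 * D s 4) by ring.
by rewrite e1 e4 hE; ring.
Qed.

(** * Rational sequences and the generic point *)

Section RationalSequence.
Variables (L : comNzRingType) (s e : nat).
Implicit Types (c u : nat -> L).

(* The first coefficients, in reverse order, of the power series
   (\sum_(i < e) u_i z^i) / (1 + \sum_(i < s) c_i z^(i+1)). *)
Fixpoint rat_coefs c u n : seq L :=
  if n is n'.+1 then
    ((if (n' < e)%N then u n' else 0) - \sum_(i < s) c i * (rat_coefs c u n')`_i)
      :: rat_coefs c u n'
  else [::].

Definition rat_coef c u n := head 0 (rat_coefs c u n.+1).

Lemma nth_rat_coefs c u n i :
  (rat_coefs c u n)`_i = if (i < n)%N then rat_coef c u (n - i.+1) else 0.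
Proof.
elim: n i => [|n ih] [|i] //; first by rewrite subn1.
by rewrite [LHS]/= ih subSS ltnS.
Qed.

Lemma rat_coef_rec c u n : rat_coef c u n = (if (n < e)%N then u n else 0) -
  \sum_(i < s) c i * (if (i < n)%N then rat_coef c u (n - i.+1) else 0).
Proof.
by rewrite {1}/rat_coef /=; congr (_ - _); apply: eq_bigr => i _; rewrite nth_rat_coefs.
Qed.

Lemma rat_coef_eq0 c u n : (e <= n)%N ->
  rat_coef c u n + \sum_(i < s) c i * (if (i < n)%N then rat_coef c u (n - i.+1) else 0) = 0.
Proof. by move=> en; rewrite rat_coef_rec ltnNge en sub0r addNr. Qed.

Lemma rat_coef_unique c u (y : nat -> L) n :
  (forall j, (j < n)%N -> y j = (if (j < e)%N then u j else 0) -
     \sum_(i < s) c i * (if (i < j)%N then y (j - i.+1)%N else 0)) ->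
  forall j, (j < n)%N -> rat_coef c u j = y j.
Proof.
move=> h j; have [d] := ubnP j; elim: d j => // d ih j jd jn.
rewrite rat_coef_rec h //; congr (_ - _); apply: eq_bigr => i _; case: ifP => // ij.
by rewrite ih //; move: jd jn ij; lia.
Qed.

Lemma eq_rat_coef c c' u u' n : (forall i, (i < s)%N -> c i = c' i) ->
  (forall i, (i < e)%N -> u i = u' i) -> rat_coef c u n = rat_coef c' u' n.
Proof.
move=> hc hu; apply: (@rat_coef_unique _ _ _ n.+1) => // j _; rewrite rat_coef_rec.
congr (_ - _); first by case: ifP => // /hu.
by apply: eq_bigr => i _; rewrite hc.
Qed.

End RationalSequence.

Lemma rmorph_rat_coef (L L' : comNzRingType) (f : {rmorphism L -> L'}) s e c u n :
  f (rat_coef s e c u n) = rat_coef s e (f \o c) (f \o u) n.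
Proof.
have [d] := ubnP n; elim: d n => // d ih n nd.
rewrite rat_coef_rec [in RHS]rat_coef_rec rmorphB rmorph_sum /=; congr (_ - _).
  by case: ifP; rewrite ?rmorph0.
apply: eq_bigr => i _; rewrite rmorphM; case: ifP => ij; rewrite ?rmorph0 // ih //.
by move: nd ij; lia.
Qed.

Lemma rat_coefZ (L : comNzRingType) s c (u : nat -> L) n :
  rat_coef s 1 c u n = u 0%N * rat_coef s 1 c (fun=> 1) n.
Proof.
apply: (@rat_coef_unique _ s 1 c u (fun n => u 0%N * rat_coef s 1 c (fun=> 1) n) n.+1) => // j _.
rewrite rat_coef_rec mulrBr.
congr (_ - _); first by case: j => [|j]; rewrite ?mulr1 ?mulr0.
by rewrite mulr_sumr; apply: eq_bigr => i _; case: ifP => _; ring.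
Qed.

Lemma rat_coefS (L : comNzRingType) s e c (u : nat -> L) n : u 0%N = 0 ->
  rat_coef s e.+1 c u n = if n is n'.+1 then rat_coef s e c (fun i => u i.+1) n' else 0.
Proof.
move=> u0; apply: (@rat_coef_unique _ s e.+1 c u
  (fun n => if n is n'.+1 then rat_coef s e c (fun i => u i.+1) n' else 0) n.+1) => // j _.
case: j => [|j]; first by rewrite u0 big1 ?subr0 // => i _; rewrite mulr0.
rewrite rat_coef_rec ltnS; congr (_ - _); apply: eq_bigr => i _.
by congr (_ * _); rewrite ltnS subSS; case: ltngtP => [ij||->] //; [rewrite -(subnSK ij)|rewrite subnn].
Qed.

(* Variables indexed by [nat], with [0] beyond the last one. *)
Definition var (R : nzRingType) n (t : nat) : {mpoly R[n]} :=
  if (insub t : option 'I_n) is Some i then 'X_i else 0.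

Lemma var_ord (R : nzRingType) n (i : 'I_n) : var R n i = 'X_i.
Proof. by rewrite /var valK. Qed.

Lemma var_out (R : nzRingType) n t : (n <= t)%N -> var R n t = 0.
Proof. by move=> h; rewrite /var insubF // ltnNge h. Qed.

Definition hankel_mx (k : fieldType) N m : 'M[{mpoly k[N]}]_m :=
  \matrix_(i, j) var k N (i + j).

Lemma hankelE (k : fieldType) m r : hankel k m r = hankel_mx k (2 * m - r - 1) m.
Proof. by []. Qed.

Lemma rmorph_mmap (R : nzRingType) (L L' : comNzRingType) n (f : {rmorphism R -> L})
  (g : {rmorphism L -> L'}) (h : 'I_n -> L) p : g (mmap f h p) = mmap (g \o f) (g \o h) p.
Proof.
rewrite /mmap rmorph_sum; apply: eq_bigr => m _; rewrite rmorphM /=; congr (_ * _).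
by rewrite /mmap1 rmorph_prod; apply: eq_bigr => i _; rewrite rmorphXn.
Qed.

Lemma eq_mmap (R : nzRingType) (L : comNzRingType) n (f f' : R -> L) (h h' : 'I_n -> L) p :
  f =1 f' -> h =1 h' -> mmap f h p = mmap f' h' p.
Proof.
move=> ef eh; rewrite /mmap; apply: eq_bigr => m _; rewrite ef; congr (_ * _).
exact: mmap1_eq.
Qed.

Lemma mmapXU (R : nzRingType) (L : comNzRingType) n (f : {rmorphism R -> L}) (h : 'I_n -> L) i :
  mmap f h 'X_i = h i.
Proof. by rewrite mmapX mmap1U. Qed.

(* The point of the affine space of dimension [N] with coordinates [x_t = w_(N-1-t)]. *)
Definition rat_point (L : comNzRingType) N s e (c u : nat -> L) (t : 'I_N) : L :=
  rat_coef s e c u (N.-1 - t).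

Definition evalpt (k : fieldType) (L : comNzRingType) (f : {rmorphism k -> L}) N s e
  (c u : nat -> L) (p : {mpoly k[N]}) : L := mmap f (@rat_point L N s e c u) p.

HB.instance Definition _ k L f N s e c u :=
  GRing.RMorphism.copy (@evalpt k L f N s e c u) (mmap f (@rat_point L N s e c u)).

Lemma rmorph_evalpt (k : fieldType) (L L' : comNzRingType) (f : {rmorphism k -> L})
  (g : {rmorphism L -> L'}) N s e c u (p : {mpoly k[N]}) :
  g (evalpt f s e c u p) = evalpt (g \o f) s e (g \o c) (g \o u) p.
Proof.
rewrite /evalpt rmorph_mmap; apply: eq_mmap => // t.
by rewrite /rat_point /= rmorph_rat_coef.
Qed.

Lemma evalpt_var (k : fieldType) (L : comNzRingType) (f : {rmorphism k -> L}) N s e c u t :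
  evalpt f s e c u (var k N t) = if (t < N)%N then rat_coef s e c u (N.-1 - t) else 0.
Proof.
by rewrite /var; case: insubP => [i -> <-|/negPf ->]; rewrite ?rmorph0 // /evalpt mmapXU.
Qed.

Definition gen_c (k : fieldType) s e (i : nat) : {mpoly k[s + e]} := var k (s + e) i.
Definition gen_u (k : fieldType) s e (i : nat) : {mpoly k[s + e]} := var k (s + e) (s + i).
Definition param (k : fieldType) N s e : {mpoly k[N]} -> {mpoly k[s + e]} :=
  evalpt (@mpolyC (s + e) k) s e (@gen_c k s e) (@gen_u k s e).
HB.instance Definition _ k N s e := GRing.RMorphism.on (@param k N s e).

(** Every rational point is a specialisation of the generic one, so an equation satisfied by the
    generic point holds at all of them. *)
Lemma param_evalpt (k : fieldType) (L : comNzRingType) (f : {rmorphism k -> L}) N s e c u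
  (p : {mpoly k[N]}) : param s e p = 0 -> evalpt f s e c u p = 0.
Proof.
move=> hp; pose h (i : 'I_(s + e)) := if (i < s)%N then c i else u (i - s)%N.
rewrite -(rmorph0 (mmap f h)) -{}hp [X in _ = X]rmorph_evalpt /evalpt.
apply: eq_mmap => [x|t]; first by rewrite /= mmapC.
apply: eq_rat_coef => i hi /=.
  rewrite /gen_c /var insubT ?ltn_addr // => h'; by rewrite mmapXU /h /= hi.
rewrite /gen_u /var insubT ?ltn_add2l // => h'; rewrite mmapXU /h /=.
by rewrite ltnNge leq_addr addKn.
Qed.

(** The rows of [V] are the coefficients of c(z) and z c(z). They annihilate the matrix because the
    recurrence holds in all degrees at least e, and m + e < N ensures that only such degrees
    occur. *)
Lemma rank_hankel_evalpt (k L : fieldType) (f : {rmorphism k -> L}) N m e c u :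
  (2 <= m)%N -> (m + e < N)%N ->
  (\rank (map_mx (evalpt f (m - 2) e c u) (hankel_mx k N m)) <= m - 2)%N.
Proof.
move=> m2 hN; set s := (m - 2)%N; set w := rat_coef s e c u.
set H := map_mx _ _; pose y t := if (t < N)%N then w (N.-1 - t)%N else 0.
have HE i j : H i j = y (i + j)%N by rewrite !mxE evalpt_var.
pose V : 'M[L]_(2, m) := \matrix_(a, j) if j == a :> nat then 1
  else if (a < j <= s + a)%N then c (j - a.+1)%N else 0.
have VH : V *m H = 0.
  apply/matrixP => a i; rewrite !mxE.
  have am : (a < m)%N by apply: leq_trans m2.
  have hn : (e <= N.-1 - (i + a))%N.
    by have := ltn_ord i; have := ltn_ord a; move: hN; lia.
  rewrite (bigD1 (Ordinal am)) //= !mxE eqxx mul1r /=.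
  transitivity (y (a + i)%N + \sum_(l < s) c l * y (a + l.+1 + i)%N).
    congr (_ + _); first by rewrite evalpt_var.
    pose F j : L := if (a < j <= s + a)%N then c (j - a.+1)%N * y (j + i)%N else 0.
    transitivity (\sum_(0 <= j < m) F j).
      rewrite big_mkord [RHS](bigD1 (Ordinal am)) //= {1}/F ltnn add0r.
      apply: eq_bigr => j ne; rewrite !mxE evalpt_var /F.
      have -> : (j == a :> nat) = false by apply: contraNF ne => /eqP ja; apply/eqP/val_inj.
      by case: ifP; rewrite ?mul0r.
    rewrite (big_cat_nat _ (n := a.+1)) //= big_nat_cond big1 => [|j]; last first.
      by rewrite andbT ltnS /F => /andP[_ ja]; rewrite ltnNge ja.
    rewrite add0r (big_cat_nat _ (n := (s + a).+1)) //=; last first.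
    - by have := ltn_ord a; rewrite /s; move: m2; lia.
    - by rewrite ltnS leq_addl.
    rewrite [X in _ + X]big_nat_cond [X in _ + X]big1 => [|j]; last first.
      by rewrite andbT /F => /andP[ja _]; rewrite [(j <= _)%N]leqNgt ja andbF.
    have -> : (s + a).+1 = (s + a.+1)%N by rewrite addnS.
    rewrite addr0 -{1}[a.+1]add0n big_addn addnK big_mkord; apply: eq_bigr => l _.
    have hl : (l + a.+1 <= s + a)%N by have := ltn_ord l; lia.
    rewrite /F leq_addl hl addnK.
    by congr (_ * y _); lia.
  have := rat_coef_eq0 s c u hn; rewrite -/w => e0; rewrite -[RHS]e0; congr (_ + _).
    rewrite /y addnC ifT //; have := ltn_ord i; have := ltn_ord a; move: hN; lia.
  apply: eq_bigr => l _; rewrite /y; congr (_ * _).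
  have -> : (a + l.+1 + i < N)%N = (l < N.-1 - (i + a))%N by lia.
  by case: ifP => // hl; congr w; lia.
have rV : (2 <= \rank V)%N.
  apply: (@det_mxsub_neq0 _ _ _ 2 id (widen_ord m2)).
  rewrite -det_tr det_trig.
    by rewrite big1 ?oner_eq0 // => a _; rewrite !mxE eqxx.
  apply/is_trig_mxP => i j ij; rewrite !mxE /= ltn_eqF //.
  by rewrite ltnNge (ltnW ij).
have := mulmx0_rank_max VH.
by rewrite /s; move: rV hN m2; lia.
Qed.

(** * Reduction to normal forms *)

Lemma minors_sub_param (k : fieldType) N m e : (2 <= m)%N -> (m + e < N)%N ->
  minors_ideal (m - 1) (hankel_mx k N m) `<=` [set p | param (m - 2) e p = 0].
Proof.
move=> m2 hN; apply: ideal_gen_sub.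
  exact: prime_ideal_is_ideal (kernel_prime_ideal (@param k N (m - 2) e)).
move=> _ [f [g [_ _ ->]]] /=; apply/eqP; rewrite -tofrac_eq0.
rewrite [X in X == _](rmorph_evalpt _ (@tofrac _)) -det_map_mx map_mxsub.
apply: contraT => /det_mxsub_neq0 h.
have := leq_trans h (rank_hankel_evalpt _ _ _ m2 hN); move: m2; lia.
Qed.

(** Reversing the columns turns Hankel matrices into Toeplitz ones, at the cost of a sign. *)
Lemma det_rev_cols (R : comNzRingType) n (A : 'M[R]_n) :
  exists b : bool, \det (\matrix_(i, j) A i (rev_ord j)) = (-1) ^+ b * \det A.
Proof.
pose s := perm (@rev_ord_inj n); exists (perm.odd_perm s).
have -> : \matrix_(i, j) A i (rev_ord j) = col_perm s A.
  by apply/matrixP => i j; rewrite !mxE permE.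
by rewrite col_permE det_mulmx det_perm odd_permV mulrC.
Qed.

Section Spanning.
Variables (k : fieldType) (N m : nat).
Hypotheses (m2 : (2 <= m)%N) (mN : (m < N)%N).
Let R := {mpoly k[N]}.
Let P := minors_ideal (m - 1) (hankel_mx k N m).

Let idP : is_ideal P. Proof. exact: is_ideal_gen. Qed.

(** These index the antidiagonals i + j = m - 2, m - 1, m, which become the three central diagonals
    when the columns are reversed. *)
Definition mid (t : nat) := (m - 2 <= t <= m)%N.

Definition mid_part (p : R) : R :=
  mmap (@mpolyC N k) (fun t : 'I_N => if mid t then 'X_t else 0) p.
HB.instance Definition _ := GRing.RMorphism.copy mid_part
  (mmap (@mpolyC N k) (fun t : 'I_N => if mid t then 'X_t else 0)).

Let mid_part_var t : mid_part (var k N t) = if mid t then var k N t else 0.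
Proof.
rewrite /var; case: insubP => [i _ <-|]; last by rewrite rmorph0; case: ifP.
by rewrite /mid_part mmapXU.
Qed.

Lemma homog_det (n : nat) (A : 'M[R]_n) : (forall i j, A i j \is 1.-homog) ->
  \det A \is n.-homog.
Proof.
move=> hA; apply: rpred_sum => s _.
have -> : (-1) ^+ perm.odd_perm s = ((-1) ^+ perm.odd_perm s : k)%:MP :> R.
  by rewrite rmorph_sign.
rewrite mul_mpolyC; apply: dhomogZ.
suff : \prod_i A i (s i) \is (\sum_(i < n) 1).-homog by rewrite sum1_card card_ord.
apply: (big_ind2 (fun (p : R) d => p \is d.-homog)) => //; first exact: dhomog1.
by move=> p d q d'; exact: dhomogM.
Qed.

Lemma var_homog t : var k N t \is 1.-homog.
Proof. rewrite /var; case: insub => [i|]; last exact: dhomog0.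
by rewrite dhomogX /= mdeg1. Qed.

Lemma mid_monomial_minors i j l : (i + j + l = m - 1)%N -> exists q,
  [/\ P q, q \is (m - 1).-homog &
    mid_part q = var k N (m - 2) ^+ i * var k N (m - 1) ^+ j * var k N m ^+ l].
Proof.
pose W q' := exists q, [/\ P q, q \is (m - 1).-homog & mid_part q = q'].
move: i j l; suff h p q : (p <= m - 1)%N -> (q <= m - 1)%N -> W (detF (m - 1) (fun i j =>
    tri (var k N (m - 2)) (var k N (m - 1)) (var k N m) (bump p i) (bump q j))).
  apply: (tri_minors_span (W := W)) h => _ _ [x [Px hx <-]] [y [Py hy <-]].
  by exists (x - y); rewrite rmorphB /= rpredB //; split=> //; exact: (is_idealB idP).
move=> pm qm.
have pm' : (p < m)%N by move: m2 pm; lia.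
have qm' : (m - 1 - q < m)%N by move: m2; lia.
have m1 : m.-1 = (m - 1)%N by rewrite subn1.
pose f (i : 'I_(m - 1)) : 'I_m := lift (Ordinal pm') (cast_ord (esym m1) i).
pose g (i : 'I_(m - 1)) : 'I_m := lift (Ordinal qm') (cast_ord (esym m1) i).
pose d := \det (mxsub f g (hankel_mx k N m)).
have hd : P d.
  apply: ideal_gen_mem; exists f, g; split=> // x y xy;
    by rewrite /f /g /= /bump; case: leqP; case: leqP; lia.
have hd1 : d \is (m - 1).-homog by apply: homog_det => x y; rewrite !mxE var_homog.
have [b hb] := det_rev_cols (mxsub f g (hankel_mx k N m)).
exists ((-1) ^+ b * d); split.
- exact: (is_idealMl _ idP).
- by case: b {hb}; rewrite ?expr0 ?expr1 ?mul1r ?mulN1r ?rpredN.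
rewrite -hb -det_map_mx; congr (\det _); apply/matrixP => x y; rewrite !mxE /= mid_part_var.
have -> : (bump (m - 1 - q) (m - 1 - y.+1) = m - 1 - bump q y)%N.
  by have := ltn_ord y; rewrite /bump; case: leqP; case: leqP; lia.
have hx : (bump p x <= m - 1)%N by have := ltn_ord x; rewrite /bump; case: leqP; lia.
have hy : (bump q y <= m - 1)%N by have := ltn_ord y; rewrite /bump; case: leqP; lia.
move: (bump p x) (bump q y) hx hy => {}x {}y hx hy; rewrite /tri /mid.
case: eqP => [->|nxy]; first by rewrite subnKC // ifT //; lia.
case: eqP => [->|nxy']; first by rewrite addSn subnKC // ifT; [congr var; lia|lia].
case: eqP => [e|nxy'']; last by rewrite ifF //; lia.
by rewrite ifT; [congr var; lia|lia].
Qed.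

Definition mid_deg (mu : 'X_{1..N}) : nat := (\sum_(t < N | mid t) mu t)%N.

Definition std (mu : 'X_{1..N}) := (mid_deg mu <= m - 2)%N.

Definition normal_forms : set R := [set p | all std (msupp p)].

Definition reducible (p : R) := exists q, normal_forms q /\ P (p - q).

Lemma normal_formsD p q : normal_forms p -> normal_forms q -> normal_forms (p + q).
Proof.
move=> /allP hp /allP hq; apply/allP => mu /msuppD_le; rewrite mem_cat.
by case/orP => [/hp|/hq].
Qed.

Lemma reducibleD p q : reducible p -> reducible q -> reducible (p + q).
Proof.
move=> [p' [np hp]] [q' [nq hq]]; exists (p' + q'); split; first exact: normal_formsD.
by rewrite opprD addrACA; apply: (is_idealD idP).
Qed.

Lemma reducibleZ c p : reducible p -> reducible (c *: p).
Proof.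
move=> [p' [/allP np hp]]; exists (c *: p'); split.
  by apply/allP => mu /msuppZ_le /np.
by rewrite -scalerBr -mul_mpolyC; apply: (is_idealMl _ idP).
Qed.

Lemma reducible0 : reducible 0.
Proof.
by exists 0; rewrite subr0; split; [rewrite /normal_forms /= msupp0|exact: (is_ideal0 idP)].
Qed.

Lemma reducible_sum (I : Type) (r : seq I) (Q : pred I) F :
  (forall i, Q i -> reducible (F i)) -> reducible (\sum_(i <- r | Q i) F i).
Proof.
by move=> h; apply: big_ind => //; [exact: reducible0|exact: reducibleD].
Qed.

Lemma reducible_add_ideal p q : P q -> reducible p -> reducible (p + q).
Proof.
move=> Pq [p' [np hp]]; exists p'; split=> //.
by rewrite addrAC; apply: (is_idealD idP).
Qed.

Lemma reducible_mul_out (t : 'I_N) p : ~~ mid t -> reducible p -> reducible ('X_t * p).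
Proof.
move=> tm [p' [/allP np hp]]; exists ('X_t * p'); split; last first.
  by rewrite -mulrBr; apply: (is_idealMl _ idP).
apply/allP => mu; rewrite mulrC (perm_mem (msuppMX _ _)) => /mapP [nu /np hnu ->].
suff e : mid_deg (U_(t) + nu)%MM = mid_deg nu by rewrite /std e.
apply: eq_bigr => t' ht'; rewrite mnmDE mnm1E; case: eqP => // e.
by rewrite e ht' in tm.
Qed.

Lemma mid_partX mu : mid_part 'X_[mu] = if [exists t : 'I_N, ~~ mid t && (0 < mu t)%N]
  then 0 else 'X_[mu].
Proof.
rewrite /mid_part mmapX /mmap1; case: ifP => [/existsP [t /andP[tm mut]]|/negbT/existsPn h].
  by rewrite (bigD1 t) //= (negPf tm) expr0n eqn0Ngt mut mul0r.
rewrite [RHS]mpolyXE_id; apply: eq_bigr => t _; have := h t.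
by case: (mid t) => //=; rewrite -eqn0Ngt => /eqP ->; rewrite !expr0.
Qed.

Lemma mid_degE mu (t2 t1 t0 : 'I_N) : t2 = (m - 2)%N :> nat -> t1 = (m - 1)%N :> nat ->
  t0 = m :> nat -> mid_deg mu = (mu t2 + mu t1 + mu t0)%N.
Proof.
move=> e2 e1 e0; rewrite /mid_deg (bigD1 t2) /=; last by rewrite /mid e2 leqnn leq_subr.
rewrite (bigD1 t1) /=; last by rewrite /mid -val_eqE /= e1 e2; move: m2; lia.
rewrite (bigD1 t0) /=; last by rewrite /mid -!val_eqE /= e0 e1 e2; move: m2; lia.
rewrite big1 ?addn0 ?addnA // => t; rewrite /mid -!val_eqE /= e0 e1 e2.
by move: m2; lia.
Qed.

(** Induction on the degree. A variable outside the middle is factored out. Otherwise, if the degree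
    is too large, a divisor of degree m - 1 is the middle part of some q in P; replacing it by minus
    the rest of q keeps the degree and puts a variable outside the middle into every monomial. *)
Lemma reducibleX mu : reducible 'X_[mu].
Proof.
have [d] := ubnP (mdeg mu); elim: d mu => // d ih mu; rewrite ltnS => hmu.
have hout nu : (mdeg nu <= d)%N -> [exists t : 'I_N, ~~ mid t && (0 < nu t)%N] ->
    reducible 'X_[nu].
  move=> hnu /existsP [t /andP[tm tnu]].
  have e : (nu = U_(t) + (nu - U_(t)))%MM by rewrite addmC submK // lep1mP -lt0n.
  rewrite e mpolyXD; apply: reducible_mul_out => //; apply: ih.
  by move: hnu; rewrite {1}e mdegD mdeg1 add1n.
have [hex|hmid] := boolP [exists t : 'I_N, ~~ mid t && (0 < mu t)%N].
  exact: hout.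
have [smu|nsmu] := leqP (mid_deg mu) (m - 2).
  exists 'X_[mu]; rewrite subrr; split; last exact: (is_ideal0 idP).
  by rewrite /normal_forms /= msuppX /= /std smu.
have [h2 h1] : (m - 2 < N)%N /\ (m - 1 < N)%N by move: mN; lia.
pose t2 := Ordinal h2; pose t1 := Ordinal h1; pose t0 := Ordinal mN.
have hsum : mid_deg mu = (mu t2 + mu t1 + mu t0)%N by exact: mid_degE.
(* The divisor of degree m - 1 is chosen greedily, and the last exponent fits because the degree of
   mu is at least m - 1. *)
pose i := minn (mu t2) (m - 1); pose j := minn (mu t1) (m - 1 - i).
pose l := (m - 1 - i - j)%N.
have hijl : (i + j + l = m - 1)%N by rewrite /l /j /i; lia.
pose nu := (U_(t2) *+ i + U_(t1) *+ j + U_(t0) *+ l)%MM.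
have nux t : nu t = ((t2 == t) * i + (t1 == t) * j + (t0 == t) * l)%N.
  by rewrite /nu !mnmDE !mulmnE !mnm1E.
have numu : (nu <= mu)%MM.
  have hij : (i <= mu t2)%N /\ (j <= mu t1)%N by rewrite /i /j !geq_minl.
  have hl : (l <= mu t0)%N by move: nsmu; rewrite hsum /l /j /i; lia.
  apply/mnm_lepP => t; rewrite nux; case: (t2 =P t) => [<-|_].
    by rewrite -!val_eqE /=; move: hij.1; move: m2; do 2 case: eqP; lia.
  case: (t1 =P t) => [<-|_]; first by rewrite -!val_eqE /=; move: hij.2; move: m2; case: eqP; lia.
  by case: (t0 =P t) => [<-|_]; lia.
have nuX : 'X_[nu] = var k N (m - 2) ^+ i * var k N (m - 1) ^+ j * var k N m ^+ l.
  by rewrite /nu !mpolyXD -!mpolyXn -(var_ord k t2) -(var_ord k t1) -(var_ord k t0).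
have [q [Pq hq qnu]] := mid_monomial_minors hijl.
rewrite -nuX in qnu; have hdnu : mdeg nu = (m - 1)%N.
  by rewrite /nu !mdegD !mdegMn !mdeg1 !mul1n.
have -> : 'X_[mu] = 'X_[mu - nu] * (mid_part q - q) + 'X_[mu - nu] * q.
  by rewrite -mulrDr subrK qnu -mpolyXD submK.
apply: reducible_add_ideal; first exact: (is_idealMl _ idP).
have hZ c (p : R) : mid_part (c *: p) = c *: mid_part p.
  by rewrite -!mul_mpolyC rmorphM /= [mid_part c%:MP]mmapC.
have -> : mid_part q - q = \sum_(la <- msupp q) q@_la *: (mid_part 'X_[la] - 'X_[la]).
  rewrite {1 2}[q]mpolyE rmorph_sum -sumrB; apply: eq_bigr => la _.
  by rewrite scalerBr -hZ.
rewrite mulr_sumr big_seq; apply: reducible_sum => la hla.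
rewrite -scalerAr; apply: reducibleZ; rewrite mid_partX; case: ifP => [hex|_]; last first.
  by rewrite subrr mulr0; exact: reducible0.
rewrite sub0r mulrN -mpolyXD -scaleN1r; apply: reducibleZ; apply: hout.
  have /dhomogP/(_ _ hla) /= := hq; rewrite mdegD => ->.
  by have := hmu; rewrite -{1}(submK numu) mdegD hdnu.
case/existsP: hex => t /andP[tm tla]; apply/existsP; exists t.
by rewrite tm mnmDE addn_gt0 tla orbT.
Qed.

Lemma reducible_all p : reducible p.
Proof.
rewrite [p]mpolyE; apply: reducible_sum => mu _; apply: reducibleZ; exact: reducibleX.
Qed.

End Spanning.

(** * Independence of the normal forms *)

(** A spanning family no larger than the dimension is free. The expansions [C] and the coefficients
    [D] satisfy C D = 1, so D has rank at least that of its row count and its rows are free. *)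
Lemma free_of_spanning (k : fieldType) s (E G : finType) (A : {set E}) (B : {set G})
  (fam : E -> {mpoly k[s]}) (mon : G -> 'X_{1..s}) : (#|A| <= #|B|)%N -> injective mon ->
  (forall g, g \in B -> exists c : E -> k, 'X_[mon g] = \sum_(e in A) c e *: fam e) ->
  forall a : E -> k, \sum_(e in A) a e *: fam e = 0 -> forall e, e \in A -> a e = 0.
Proof.
move=> hAB inj hspan a ha e eA.
have /choice [c hc] g : exists c : E -> k,
    g \in B -> 'X_[mon g] = \sum_(e in A) c e *: fam e.
  by case gB: (g \in B); [have [c hc] := hspan g gB; exists c|exists a].
pose C : 'M[k]_(#|B|, #|A|) := \matrix_(i, j) c (enum_val i) (enum_val j).
pose D : 'M[k]_(#|A|, #|B|) := \matrix_(i, j) (fam (enum_val i))@_(mon (enum_val j)).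
have CD : C *m D = 1%:M.
  apply/matrixP => i j; rewrite !mxE.
  transitivity ('X_[mon (enum_val i)] : {mpoly k[s]})@_(mon (enum_val j)); last first.
    by rewrite mcoeffX (inj_eq inj) (inj_eq enum_val_inj).
  rewrite hc ?enum_valP // raddf_sum [RHS]big_enum_val /=; apply: eq_bigr => l _.
  by rewrite !mxE mcoeffZ.
have rD : row_free D.
  rewrite /row_free eqn_leq rank_leq_row /=; apply: leq_trans hAB _.
  by rewrite -{1}(mxrank1 k #|B|) -CD mxrankM_maxr.
pose v : 'rV[k]_#|A| := \row_i a (enum_val i).
have : v *m D = 0.
  apply/matrixP => i j; rewrite !mxE.
  transitivity (\sum_(e in A) a e *: fam e)@_(mon (enum_val j)); last by rewrite ha mcoeff0.
  rewrite raddf_sum [RHS]big_enum_val /=; apply: eq_bigr => l _.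
  by rewrite !mxE mcoeffZ.
move/eqP; rewrite mulmx_free_eq0 // => /eqP/matrixP/(_ 0 (enum_rank_in eA e)).
by rewrite !mxE enum_rankK_in.
Qed.

Section Independence.
Variables (k : fieldType) (s : nat).
Hypothesis s1 : (1 <= s)%N.
Let R := {mpoly k[s.+4]}.
Let S := {mpoly k[s]}.
Let P := minors_ideal (s.+2 - 1) (hankel_mx k s.+4 s.+2).

(** The coefficients of 1 / c(z). Up to sign the variables are the elementary symmetric functions
    and [h] the complete ones, so the [h j] generate the ring. *)
Let h (j : nat) : S := rat_coef s 1 (var k s) (fun=> 1) j.
Let psi : R -> S := evalpt (@mpolyC s k) s 1 (var k s) (fun=> 1).
HB.instance Definition _ := GRing.RMorphism.on psi.

Let psiZ c p : psi (c *: p) = c *: psi p.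
Proof. by rewrite -!mul_mpolyC rmorphM /= [psi c%:MP]mmapC. Qed.

Let h0 : h 0 = 1.
Proof. by rewrite /h rat_coef_rec big1 ?subr0 // => i _; rewrite mulr0. Qed.

Let hS j : h j.+1 = - \sum_(i < s) var k s i * (if (i < j.+1)%N then h (j - i) else 0).
Proof. by rewrite /h rat_coef_rec sub0r. Qed.

Let h_homog j : h j \is j.-homog for (@mnmwgt s).
Proof.
have [d] := ubnP j; elim: d j => // d ih [|j] jd; first by rewrite h0 dhomog1.
rewrite hS rpredN; apply: rpred_sum => i _; case: ifP => ij; last by rewrite mulr0 rpred0.
have -> : j.+1 = (i.+1 + (j - i))%N by lia.
apply: dhomogM; last by apply: ih; lia.
by rewrite var_ord dhomogX /= mnmwgt1.
Qed.

Let psi_var j : (j < s.+4)%N -> psi (var k s.+4 (s.+3 - j)) = h j.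
Proof.
move=> hj; rewrite /psi evalpt_var ltnS leq_subr subKn //.
Qed.

Let psi_surj_var (i : 'I_s) : exists q, psi q = 'X_i.
Proof.
have [d] := ubnP i; elim: d i => // d ih i id.
have hi : h i.+1 = - (var k s i + \sum_(l < s | l != i) var k s l * (if (l < i.+1)%N then h (i - l) else 0)).
  by rewrite hS (bigD1 i) //= ltnS leqnn subnn h0 mulr1.
have /choice [q hq] (l : 'I_s) : exists q, (l < i)%N -> psi q = 'X_l.
  case li: (l < i)%N; last by exists 0.
  by have [|q hq] := ih l; [lia|exists q].
exists (- var k s.+4 (s.+3 - i.+1) - \sum_(l < s | l != i) q l *
  (if (l < i.+1)%N then var k s.+4 (s.+3 - (i - l)) else 0)).
rewrite rmorphB rmorphN rmorph_sum /= psi_var; last by have := ltn_ord i; lia.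
rewrite hi opprK var_ord; apply/eqP; rewrite subr_eq; apply/eqP; congr (_ + _).
apply: eq_bigr => l li; rewrite rmorphM; case: ifP => li'; last by rewrite rmorph0 !mulr0.
rewrite /= psi_var; last by have := ltn_ord i; lia.
rewrite var_ord hq //; have : (l != i :> nat) by []; lia.
Qed.

Let psi_surj mu : exists q, psi q = 'X_[mu].
Proof.
have /choice [q hq] := psi_surj_var.
exists (\prod_i q i ^+ mu i); rewrite rmorph_prod mpolyXE_id.
by apply: eq_bigr => i _; rewrite rmorphXn /= hq.
Qed.

Let psi_minors p : P p -> psi p = 0.
Proof.
have e : (s.+2 - 2 = s)%N by rewrite subn2.
move=> Pp; have := @minors_sub_param k s.+4 s.+2 1 isT _ p Pp.
rewrite addn1 ltnS leqnn => /(_ isT) /(param_evalpt (@mpolyC s k) (var k s) (fun=> 1)).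
by rewrite e.
Qed.

(** [ex mu j] is the exponent of w_j = x_(s+3-j). In [wt], w_j has weight j, so w_0, which [psi]
    sends to 1, does not count; the middle variables are w_1, w_2, w_3. *)
Let ex (mu : 'X_{1..s.+4}) j := mu (inord (s.+3 - j)).
Let wt (mu : 'X_{1..s.+4}) := (ex mu 1 + (ex mu 2).*2 + ex mu 3 * 3 + \sum_(i < s) ex mu (i + 4) * (i + 4))%N.

Let prod_rev (F : 'I_s.+4 -> S) : \prod_t F t =
  F (inord (s.+3 - 0)) * (F (inord (s.+3 - 1)) * F (inord (s.+3 - 2)) * F (inord (s.+3 - 3)) *
   \prod_(i < s) F (inord (s.+3 - (i + 4)))).
Proof.
pose G j := F (inord (s.+3 - j)).
rewrite [RHS](_ : _ = G 0%N * (G 1%N * G 2%N * G 3%N * \prod_(i < s) G (i + 4)%N)) //.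
transitivity (\prod_(j < s.+4) G j).
  rewrite (reindex_inj rev_ord_inj) /=; apply: eq_bigr => j _; rewrite /G; congr F.
  by apply: val_inj; rewrite /= inordK ?subSS // ltnS leq_subr.
move: (G) => {}G; rewrite !big_ord_recl !mulrA; congr (_ * _).
by apply: eq_bigr => i _; congr G; rewrite addn4.
Qed.

Let psiX mu : psi 'X_[mu] =
  h 1 ^+ ex mu 1 * h 2 ^+ ex mu 2 * h 3 ^+ ex mu 3 * \prod_(i < s) h (i + 4) ^+ ex mu (i + 4).
Proof.
rewrite mpolyXE_id rmorph_prod /=.
under eq_bigr do rewrite rmorphXn /= -var_ord.
rewrite (prod_rev (fun i => psi (var k s.+4 i) ^+ mu i)).
have e j : (j < s.+4)%N -> psi (var k s.+4 (inord (s.+3 - j) : 'I_s.+4)) = h j.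
  by move=> hj; rewrite inordK ?ltnS ?leq_subr // psi_var.
rewrite !e // h0 expr1n mul1r; congr (_ * _); apply: eq_bigr => i _.
by rewrite e //; have := ltn_ord i; lia.
Qed.

Let psiX_homog mu : psi 'X_[mu] \is (wt mu).-homog for (@mnmwgt s).
Proof.
rewrite psiX /wt; have hX j n : h j ^+ n \is (n * j).-homog for (@mnmwgt s).
  by rewrite mulnC; apply: dhomogMn.
apply: dhomogM; first apply: dhomogM; first apply: dhomogM.
- by have := hX 1%N (ex mu 1); rewrite muln1.
- by have := hX 2%N (ex mu 2); rewrite muln2.
- exact: hX.
apply: (big_ind2 (fun (p : S) d => p \is d.-homog for (@mnmwgt s))) => //.
- exact: dhomog1.
- by move=> p d q d'; exact: dhomogM.
Qed.

Let stdE mu : std s.+2 mu = (ex mu 1 + ex mu 2 + ex mu 3 <= s)%N.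
Proof.
rewrite /std subn2 /=; congr (_ <= _)%N.
rewrite (@mid_degE _ _ _ _ mu (inord (s.+3 - 3)) (inord (s.+3 - 2)) (inord (s.+3 - 1))) //.
- by rewrite /ex; lia.
all: by rewrite inordK; lia.
Qed.

Section FixedWeight.
Variable n : nat.
Let E := (('I_s.+1 * 'I_s.+1 * 'I_s.+1) * {ffun 'I_s -> 'I_n.+1})%type.

(** The exponents of h 1, h 2, h 3 are the successive differences of t >= u >= v >= 0. Thus t is
    their sum, and the bound s on the middle degree becomes the bound on the largest part. *)
Let fam (e : E) : S := h 1 ^+ (e.1.1.1 - e.1.1.2) * h 2 ^+ (e.1.1.2 - e.1.2) *
  h 3 ^+ e.1.2 * \prod_(i < s) h (i + 4) ^+ e.2 i.

Let enc (mu : 'X_{1..s.+4}) : E :=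
  ((inord (ex mu 1 + ex mu 2 + ex mu 3), inord (ex mu 2 + ex mu 3), inord (ex mu 3)),
   [ffun i : 'I_s => inord (ex mu (i + 4))]).

Let encE mu : std s.+2 mu -> wt mu = n ->
  [/\ (enc mu).1.1.1 = (ex mu 1 + ex mu 2 + ex mu 3)%N :> nat,
      (enc mu).1.1.2 = (ex mu 2 + ex mu 3)%N :> nat, (enc mu).1.2 = ex mu 3 :> nat
    & forall i : 'I_s, (enc mu).2 i = ex mu (i + 4) :> nat].
Proof.
rewrite stdE => hs hn; rewrite /enc /=; split; try by rewrite inordK //; lia.
move=> i; rewrite ffunE inordK // ltnS -hn /wt (bigD1 i) //=.
by set X := (\sum_(_ < _ | _) _)%N; set y := ex mu (i + 4); rewrite mulnDr; lia.
Qed.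

Let fam_enc mu : std s.+2 mu -> wt mu = n -> fam (enc mu) = psi 'X_[mu].
Proof.
move=> hs hn; have [e1 e2 e3 e4] := encE hs hn.
rewrite psiX /fam e1 e2 e3 -addnA addnK addnK; congr (_ * _).
by apply: eq_bigr => i _; rewrite e4.
Qed.

Let enc_box mu : std s.+2 mu -> wt mu = n -> enc mu \in box_partition_ffuns s n.
Proof.
move=> hs hn; have [e1 e2 e3 e4] := encE hs hn.
rewrite inE e1 e2 e3 -addnA !leq_addl !andTb; apply/eqP.
transitivity (wt mu) => //; rewrite /wt; congr (_ + _)%N; first lia.
by apply: eq_bigr => i _; rewrite e4.
Qed.

(** [enc] ignores the exponent of w_0, which the degree recovers. *)
Let enc_inj mu nu : std s.+2 mu -> wt mu = n -> std s.+2 nu -> wt nu = n ->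
  mdeg mu = mdeg nu -> enc mu = enc nu -> mu = nu.
Proof.
move=> hs hn hs' hn' hd he; have [e1 e2 e3 e4] := encE hs hn.
have [] := encE hs' hn'; rewrite -he e1 e2 e3 => e1' e2' e3' e4'.
have hex j : (0 < j < s.+4)%N -> ex mu j = ex nu j.
  case: j => [//|[|[|[|j]]]] hj; try lia.
  by have := e4' (Ordinal (hj : (j < s)%N)); rewrite e4 /= addn4.
have hneq (t : 'I_s.+4) : t != ord_max -> mu t = nu t.
  move=> tm; have := hex (s.+3 - t)%N; rewrite /ex subKn; last by rewrite -ltnS.
  rewrite inord_val; apply; rewrite subn_gt0 ltn_neqAle tm /= -ltnS ltn_ord /=.
  by rewrite ltnS leq_subr.
apply/mnmP => t; have [->|/hneq//] := eqVneq t ord_max.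
move: hd; rewrite !mdegE (bigD1 ord_max) //= [RHS](bigD1 ord_max) //=.
by rewrite (eq_bigr (fun i => nu i)) // => /addIn.
Qed.

(** By surjectivity the monomial is the image of some q; q is reduced to a normal form modulo P, and
    the component of weight n is extracted. *)
Let span_fam (g : {ffun 'I_s -> 'I_n.+1}) : g \in partition_ffuns s n ->
  exists c : E -> k,
    'X_[[multinom g i : nat | i < s]] = \sum_(e in box_partition_ffuns s n) c e *: fam e.
Proof.
rewrite inE => /eqP hg; set mu := [multinom _ | _ < _].
have wmu : mnmwgt mu = n by rewrite -hg; apply: eq_bigr => i _; rewrite mnmE.
have [q hq] := psi_surj mu.
have [q' [/allP nfq /psi_minors]] := @reducible_all k s.+4 s.+2 isT (leqnSn _) q.
rewrite rmorphB /= hq => /eqP; rewrite subr_eq0 => /eqP e.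
pose T nu := (wt nu == n).
exists (fun e => \sum_(nu <- msupp q' | T nu && (enc nu == e)) q'@_nu).
have -> : 'X_[mu] = \sum_(nu <- msupp q' | T nu) q'@_nu *: psi 'X_[nu].
  have <- : pihomog (@mnmwgt s) n 'X_[k, mu] = 'X_[mu] by rewrite pihomogX /= wmu eqxx.
  rewrite e {1}[q']mpolyE rmorph_sum raddf_sum [RHS]big_mkcond /=; apply: eq_bigr => nu _.
  rewrite psiZ linearZ /= /T; case: eqP => [en|/eqP en].
    by rewrite pihomog_dE // -en.
  by rewrite (pihomog_ne0 en (psiX_homog nu)) scaler0.
rewrite big_seq_cond (partition_big enc (mem (box_partition_ffuns s n))) /=; last first.
  by move=> nu /andP[/nfq hs /eqP hn]; exact: enc_box.
apply: eq_bigr => e' _; rewrite scaler_suml [RHS]big_seq_cond; apply: eq_big => nu.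
  by rewrite andbA.
by case/andP=> /andP[/nfq hs /eqP hn] /eqP <-; rewrite fam_enc.
Qed.

Lemma fam_free (a : E -> k) : \sum_(e in box_partition_ffuns s n) a e *: fam e = 0 ->
  forall e, e \in box_partition_ffuns s n -> a e = 0.
Proof.
apply: (@free_of_spanning k s _ _ (box_partition_ffuns s n) (partition_ffuns s n) fam
  (fun g => [multinom g i : nat | i < s])).
- by rewrite card_box_partition_ffuns.
- move=> g g' /mnmP e; apply/ffunP => i; apply: val_inj.
  by have := e i; rewrite !mnmE.
- exact: span_fam.
Qed.

Lemma normal_form_coef (p : R) d : normal_forms s.+2 p ->
  \sum_(nu <- msupp p | mdeg nu == d) p@_nu *: psi 'X_[nu] = 0 ->
  forall nu, nu \in msupp p -> mdeg nu = d -> wt nu = n -> p@_nu = 0.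
Proof.
move=> /allP nf hsum nu0 hnu0 hd0 hn0.
pose T nu := (mdeg nu == d) && (wt nu == n).
have hT : \sum_(nu <- msupp p | T nu) p@_nu *: psi 'X_[nu] = 0.
  have := congr1 (pihomog (@mnmwgt s) n) hsum; rewrite raddf0 raddf_sum => h1; rewrite -[RHS]h1.
  rewrite big_mkcondr /=; apply: eq_bigr => nu _; rewrite linearZ /=; case: eqP => [en|/eqP en].
    by rewrite pihomog_dE // -en.
  by rewrite (pihomog_ne0 en (psiX_homog nu)) scaler0.
have := @fam_free (fun e => \sum_(nu <- msupp p | T nu && (enc nu == e)) p@_nu) _ (enc nu0).
rewrite enc_box ?nf // => <- //.
  rewrite big_mkcond (bigD1_seq nu0) ?msupp_uniq //= {1}/T hd0 hn0 !eqxx /=.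
  rewrite big_seq_cond big1 ?addr0 // => nu /andP[hnu /eqP ne].
  case: ifP => // /andP[/andP[/eqP hd /eqP hn] /eqP he]; case: ne.
  by apply: enc_inj; rewrite ?nf // hd.
rewrite -[RHS]hT [RHS]big_seq_cond (partition_big enc (mem (box_partition_ffuns s n))) /=.
  apply: eq_bigr => e' _; rewrite scaler_suml [LHS]big_seq_cond; apply: eq_big => nu.
    by rewrite andbA.
  by case/and3P=> /nf hs /andP[_ /eqP hn] /eqP <-; rewrite fam_enc.
by move=> nu /and3P[/nf hs _ /eqP hn]; exact: enc_box.
Qed.

End FixedWeight.

Lemma normal_form_param_eq0 (p : R) : normal_forms s.+2 p ->
  param (s.+2 - 2) 1 p = 0 -> p = 0.
Proof.
move=> nf hp; apply/eqP; rewrite -msupp_eq0; apply/eqP; case em: (msupp p) => [//|nu0 r].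
have hnu0 : nu0 \in msupp p by rewrite em mem_head.
suff : p@_nu0 = 0 by move/eqP; rewrite mcoeff_eq0 hnu0.
apply: (normal_form_coef nf _ hnu0 (erefl (mdeg nu0)) (erefl (wt nu0))).
(* A numerator equal to an indeterminate multiplies every coordinate by it, so its powers separate
   the degrees that [psi] mixes. *)
pose f := @polyC S \o @mpolyC s k.
have := param_evalpt f (fun i => (var k s i)%:P) (fun=> 'X) hp.
rewrite subn2 /= /evalpt /mmap => /(congr1 (fun q : {poly S} => q`_(mdeg nu0))).
rewrite coef0 coef_sum => h1; rewrite -[RHS]h1 big_mkcond; apply: eq_bigr => nu _ /=.
have -> : mmap1 (rat_point s 1 (fun i => (var k s i)%:P) (fun=> 'X : {poly S})) nu =
    'X^(mdeg nu) * (psi 'X_[nu])%:P.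
  rewrite /psi /evalpt mmapX /mmap1 rmorph_prod mdegE expr_sum -big_split /=.
  apply: eq_bigr => t _; rewrite rmorphXn -exprMn; congr (_ ^+ _).
  by rewrite /rat_point rat_coefZ [X in _ = _ * X](rmorph_rat_coef (@polyC S)).
rewrite coefCM coefXnM; case: ltngtP => [||->].
- by rewrite mulr0.
- by move=> hlt; rewrite coefC subn_eq0 leqNgt hlt mulr0.
by rewrite subnn coefC eqxx mul_mpolyC.
Qed.

Lemma param_sub_minors_base p : param (s.+2 - 2) 1 p = 0 -> P p.
Proof.
move=> hp; have [q [nq hq]] := @reducible_all k s.+4 s.+2 isT (leqnSn _) p.
have hq0 : param (s.+2 - 2) 1 (p - q) = 0.
  by apply: (@minors_sub_param k s.+4 s.+2 1) => //; rewrite addn1.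
move: hq; suff -> : q = 0 by rewrite subr0.
by apply: normal_form_param_eq0 => //; move/eqP: hq0; rewrite rmorphB /= hp sub0r oppr_eq0 => /eqP.
Qed.

End Independence.

(** * The ideal of minors is prime *)

Lemma mpoly_subring_ind (R : nzRingType) n (T : {mpoly R[n]} -> Prop) :
  (forall c, T c%:MP) -> (forall i, T 'X_i) -> (forall p q, T p -> T q -> T (p + q)) ->
  (forall p q, T p -> T q -> T (p * q)) -> forall p, T p.
Proof.
move=> TC TX TD TM p; rewrite [p]mpolyE.
apply: (big_ind T) => [||m _] //; first by rewrite -mpolyC0.
rewrite -mul_mpolyC; apply: (TM) => //; rewrite mpolyXE_id.
apply: (big_ind T) => [||i _] //; first by rewrite -mpolyC1.
by elim: (m i) => [|l ih]; rewrite ?expr0 -?mpolyC1 // exprS; apply: (TM).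
Qed.

Section LastVariable.
Variables (k : fieldType) (N : nat).

(** Sets the last variable, w_0, to 0: [var] is 0 out of range. *)
Definition restr : {mpoly k[N.+1]} -> {mpoly k[N]} :=
  mmap (@mpolyC N k) (fun t : 'I_N.+1 => var k N t).
HB.instance Definition _ := GRing.RMorphism.on restr.

Lemma restr_var t : restr (var k N.+1 t) = var k N t.
Proof.
rewrite {1}/var; case: insubP => [i _ <-|]; first by rewrite /restr mmapXU.
by rewrite -leqNgt => h; rewrite rmorph0 var_out // ltnW.
Qed.

Lemma mwiden_restr p : exists g, p = mwiden (restr p) + var k N.+1 N * g.
Proof.
move: p; apply: mpoly_subring_ind => [c|i|q q' [g e] [g' e']|q q' [g e] [g' e']].
- by exists 0; rewrite /restr mmapC mwidenC mulr0 addr0.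
- rewrite -var_ord; case: (ltngtP i N) => [h||->].
  + exists 0; rewrite restr_var mulr0 addr0 /var insubT; first by rewrite ltnW.
    by move=> h'; rewrite insubT mwidenX mnmwiden1; congr ('X_ _); apply: val_inj.
  + by move=> h; have := ltn_ord i; rewrite ltnS leqNgt h.
  + by exists 1; rewrite restr_var (var_out _ (leqnn N)) mwiden0 add0r mulr1.
- by exists (g + g'); rewrite {1}e {1}e' rmorphD /= mwidenD; ring.
exists (mwiden (restr q) * g' + g * mwiden (restr q') + var k N.+1 N * g * g').
by rewrite {1}e {1}e' rmorphM /= mwidenM; ring.
Qed.

End LastVariable.

Section Homogeneous.
Variables (k : fieldType) (N : nat).
Let R := {mpoly k[N]}.

Lemma pihomogXM d m (p : R) : pihomog (@mdeg N) d ('X_[m] * p) =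
  if (mdeg m <= d)%N then 'X_[m] * pihomog (@mdeg N) (d - mdeg m) p else 0.
Proof.
have hs c : pihomog (@mdeg N) c p = \sum_(nu <- msupp p) p@_nu *: pihomog (@mdeg N) c 'X_[nu].
  by rewrite {1}[p]mpolyE raddf_sum; apply: eq_bigr => nu _; rewrite /= linearZ.
rewrite hs {1}[p]mpolyE !mulr_sumr raddf_sum /=; case: leqP => [md|dm]; last first.
  rewrite big1 // => nu _; rewrite -scalerAr -mpolyXD linearZ /= pihomogX /= mdegD.
  by rewrite gtn_eqF ?scaler0 // ltn_addr.
apply: eq_bigr => nu _; rewrite -scalerAr -mpolyXD linearZ /=.
rewrite -scalerAr !pihomogX /= mdegD -{1}(subnKC md) eqn_add2l.
by case: eqP; rewrite ?mulr0 // mpolyXD.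
Qed.

Lemma homogeneous_ideal_gen (A : set R) d0 : (forall a, A a -> a \is d0.-homog) ->
  forall d p, ideal_gen A p -> ideal_gen A (pihomog (@mdeg N) d p).
Proof.
move=> hA d p hp; move: p hp d; have hI := is_ideal_gen A.
apply: (@ideal_gen_sub _ _ [set p | forall d, ideal_gen A (pihomog (@mdeg N) d p)]).
  split=> [d|a u v hu hv d]; first by rewrite /= raddf0; apply: (is_ideal0 hI).
  rewrite raddfD; apply: (is_idealD hI); last exact: hv.
  rewrite /= {1}[a]mpolyE mulr_suml raddf_sum.
  apply: (is_ideal_sum _ hI) => m _; rewrite -scalerAl /= linearZ /= -mul_mpolyC.
  apply: (is_idealMl _ hI); rewrite pihomogXM; case: ifP => _; last exact: (is_ideal0 hI).
  by apply: (is_idealMl _ hI); apply: hu.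
move=> a Aa d /=; have [<-|ne] := eqVneq d0 d.
  by rewrite pihomog_dE ?hA //; apply: ideal_gen_mem.
by rewrite (pihomog_ne0 ne (hA _ Aa)); apply: (is_ideal0 hI).
Qed.

End Homogeneous.

(** A numerator with u_0 = 0 has w_0 = 0, and dividing the series by z gives the generic point with
    one coordinate and one numerator coefficient fewer. *)
Lemma param_restr (k : fieldType) s e N (p : {mpoly k[N.+1]}) :
  param s e.+1 p = 0 -> param s e (restr p) = 0.
Proof.
pose u' i : {mpoly k[s + e]} := if i is i'.+1 then gen_u k s e i' else 0.
move=> /(param_evalpt (@mpolyC (s + e) k) (gen_c k s e) u') <-.
rewrite /restr rmorph_mmap /evalpt; apply: eq_mmap => [x|t] /=.
  by rewrite /param /evalpt mmapC.
rewrite /param evalpt_var /rat_point rat_coefS //=.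
have -> : (N.-1 - t = N - t.+1)%N by lia.
case: (ltngtP t N) => [h||->]; last by rewrite subnn.
  by rewrite -(subnSK h).
by move=> h; have := ltn_ord t; rewrite ltnS leqNgt h.
Qed.

Section KernelStep.
Variables (k : fieldType) (s e N : nat).
Hypotheses (hN : (s.+2 + e.+1 < N.+1)%N).
Let m := s.+2.
Let R := {mpoly k[N.+1]}.
Let P' := minors_ideal (m - 1) (hankel_mx k N m).
Let P := minors_ideal (m - 1) (hankel_mx k N.+1 m).
Let X : R := var k N.+1 N.
Let ker : set R := [set p | param s e.+1 p = 0].
Hypothesis IH : forall p : {mpoly k[N]}, param s e p = 0 -> P' p.

Let idP : is_ideal P. Proof. exact: is_ideal_gen. Qed.

Let P_ker p : P p -> ker p.
Proof.
by have := @minors_sub_param k N.+1 m e.+1 isT hN p; rewrite subn2.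
Qed.

Let X_nker : ~ ker X.
Proof.
rewrite /ker /= /param evalpt_var ltnSn /= subnn rat_coef_rec /= big1; last first.
  by move=> i _; rewrite mulr0.
move/eqP; rewrite subr0 /gen_u addn0 /var insubT; first by rewrite -addn1 leq_add2l.
by move=> h; rewrite -mleadc_eq0 mleadXm mcoeffX eqxx oner_eq0.
Qed.

Let lift_minors p : P' p -> exists g, P (mwiden p + X * g).
Proof.
move: p; apply: ideal_gen_sub => [|_ [f [g [hf hg ->]]]]; last first.
  set d := \det (mxsub f g (hankel_mx k N.+1 m)).
  have Pd : P d by apply: ideal_gen_mem; exists f, g.
  have [g' e'] := mwiden_restr d.
  exists g'; rewrite (_ : _ + _ = d) // [RHS]e'; congr (mwiden _ + _).
  rewrite /d -det_map_mx map_mxsub; congr (\det (mxsub _ _ _)).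
  by apply/matrixP => i j; rewrite !mxE /= restr_var.
split=> [|a u v [g hg] [g' hg']]; first by exists 0; rewrite mwiden0 mulr0 addr0; apply: (is_ideal0 idP).
exists (mwiden a * g + g'); rewrite mwidenD mwidenM.
have -> : mwiden a * mwiden u + mwiden v + X * (mwiden a * g + g') =
  mwiden a * (mwiden u + X * g) + (mwiden v + X * g') by ring.
exact: idP.2.
Qed.

Let ker_step p : ker p -> exists g, ker g /\ P (p - X * g).
Proof.
move=> kp; have [g0 e0] := mwiden_restr p.
have [g1 h1] := lift_minors (IH (param_restr kp)).
have h : P (p - X * (g0 - g1)).
  have -> : p - X * (g0 - g1) = mwiden (restr p) + X * g1 by rewrite {1}e0 -/X; ring.
  by [].
exists (g0 - g1); split=> //; have kprime : prime_ideal ker := kernel_prime_ideal (@param k N.+1 s e.+1).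
have : ker (X * (g0 - g1)).
  rewrite -[_ * _](subKr p); apply: (is_idealB (prime_ideal_is_ideal kprime)) => //.
  exact: P_ker.
by case/(prime_idealM kprime).
Qed.

(** Iterating [ker_step] puts p in P + (w_0^n) for every n. For n = d + 1 the second summand does
    not reach degree d, so the degree d component of p is that of an element of the homogeneous
    ideal P. *)
Lemma param_sub_minors_step p : param s e.+1 p = 0 -> P p.
Proof.
move=> kp; have hiter n : exists g, ker g /\ P (p - X ^+ n * g).
  elim: n => [|n [g [kg hg]]]; first by exists p; rewrite expr0 mul1r subrr; split=> //; exact: (is_ideal0 idP).
  have [g' [kg' hg']] := ker_step kg; exists g'; split=> //.
  have -> : p - X ^+ n.+1 * g' = (p - X ^+ n * g) + X ^+ n * (g - X * g').
    by rewrite exprSr; ring.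
  by apply: (is_idealD idP) => //; apply: (is_idealMl _ idP).
rewrite (pihomog_partitionE (leqnn (msize p))); apply: (is_ideal_sum _ idP) => d _.
have [g [_ hg]] := hiter d.+1.
have -> : pihomog (@mdeg N.+1) d p = pihomog (@mdeg N.+1) d (p - X ^+ d.+1 * g).
  rewrite raddfB /= /X -[N in var _ _ N]/(val (@ord_max N)) var_ord mpolyXn pihomogXM.
  by rewrite mdegMn mdeg1 mul1n ltnn subr0.
apply: (homogeneous_ideal_gen (d0 := (m - 1)%N)) hg => _ [f [g' [_ _ ->]]].
by apply: homog_det => i j; rewrite !mxE var_homog.
Qed.

End KernelStep.

Theorem param_kernel (k : fieldType) s e (s1 : (1 <= s)%N) :
  forall p : {mpoly k[s.+4 + e]}, param s e.+1 p = 0 ->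
    minors_ideal (s.+2 - 1) (hankel_mx k (s.+4 + e) s.+2) p.
Proof.
elim: e => [|e ih].
  rewrite addn0 => p hp; apply: (param_sub_minors_base s1); move: hp; rewrite subn2.
  exact.
rewrite addnS => p; apply: param_sub_minors_step => //.
by lia.
Qed.

(** * Upper bounds for heights *)

Section AlgebraicDependence.
Variables (k : fieldType) (n M : nat) (F : 'I_M -> {mpoly k[n]}).
Hypothesis nM : (n < M)%N.

Let E := (\max_i msize (F i))%N.
Let C := (M * E.+3 + 2)%N.
Let D := (C ^ n).+1.

Let prodF (al : {ffun 'I_M -> 'I_D}) : {mpoly k[n]} := \prod_i F i ^+ al i.

Let msize_prodF al : (msize (prodF al) < C * D)%N.
Proof.
have hX i a : (msize (F i ^+ a) <= a * E.+1 + 1)%N.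
  elim: a => [|a ih]; first by rewrite expr0 msize1.
  rewrite exprS; apply: leq_trans (msizeM_le _ _) _.
  have : (msize (F i) <= E)%N by apply: leq_bigmax.
  by move: ih; lia.
have h : (msize (prodF al) <= \sum_i (al i * E.+1 + 2) + 1)%N.
  rewrite /prodF; apply: (big_rec2 (fun (p : {mpoly k[n]}) d => (msize p <= d + 1)%N)).
    by rewrite msize1.
  move=> i p d _ hp; apply: leq_trans (msizeM_le _ _) _.
  by have := hX i (al i); move: hp; lia.
apply: leq_ltn_trans h _.
have : (\sum_i (al i * E.+1 + 2) <= \sum_(i < M) (D * E.+3))%N.
  by apply: leq_sum => i _; have := ltn_ord (al i); rewrite /D; nia.
by rewrite sum_nat_const card_ord /C; rewrite /D; nia.
Qed.

(** There are D^M products of powers with exponents below D, and they involve only monomials with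
    all n exponents below C D. As M > n and D > C^n, D^M exceeds (C D)^n, so the products are
    linearly dependent. *)
Lemma algebraic_dependence : exists G : {mpoly k[M]}, G != 0 /\ mmap (@mpolyC n k) F G = 0.
Proof.
pose A := {ffun 'I_M -> 'I_D}; pose B := {ffun 'I_n -> 'I_(C * D)}.
pose mA (al : A) := [multinom al i : nat | i < M].
pose mB (be : B) := [multinom be i : nat | i < n].
pose mx : 'M[k]_(#|A|, #|B|) := \matrix_(i, j) (prodF (enum_val i))@_(mB (enum_val j)).
have hr : (\rank mx < #|A|)%N.
  apply: leq_ltn_trans (rank_leq_col _) _; rewrite !card_ffun !card_ord expnMn.
  have D0 : (0 < D)%N by [].
  apply: (@leq_trans (D ^ n.+1)); last by rewrite leq_pexp2l.
  by rewrite expnS ltn_pmul2r ?expn_gt0.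
have : kermx mx != 0 by rewrite kermx_eq0 -row_leq_rank -ltnNge.
case/rowV0Pn => v /sub_kermxP vmx v0.
pose G : {mpoly k[M]} := \sum_i v 0 i *: 'X_[mA (enum_val i)].
have injA : injective mA.
  by move=> a b /mnmP e; apply/ffunP => i; apply: val_inj; have := e i; rewrite !mnmE.
exists G; split.
  apply: contraNneq v0 => G0; apply/eqP/rowP => j; rewrite mxE.
  have := congr1 (mcoeff (mA (enum_val j))) G0; rewrite mcoeff0 => <-.
  rewrite raddf_sum (bigD1 j) //= big1 => [|i ij]; first by rewrite mcoeffZ mcoeffX eqxx mulr1 addr0.
  by rewrite mcoeffZ mcoeffX (inj_eq injA) (inj_eq enum_val_inj) (negPf ij) mulr0.
have -> : mmap (@mpolyC n k) F G = \sum_i v 0 i *: prodF (enum_val i).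
  rewrite rmorph_sum; apply: eq_bigr => i _; rewrite /= mmapZ mul_mpolyC mmapX; congr (_ *: _).
  by apply: eq_bigr => l _; rewrite mnmE.
apply/mpolyP => mu; rewrite mcoeff0 raddf_sum /=.
have [/forallP hmu|] := boolP [forall i, (mu i < C * D)%N].
  pose be : B := [ffun i => Ordinal (hmu i)].
  have -> : mu = mB (enum_val (enum_rank be)).
    by rewrite enum_rankK; apply/mnmP => i; rewrite mnmE ffunE.
  have /matrixP/(_ 0 (enum_rank be)) := vmx; rewrite !mxE => h; rewrite -[RHS]h.
  by apply: eq_bigr => i _; rewrite mcoeffZ mxE.
rewrite negb_forall => /existsP [i]; rewrite -leqNgt => hi.
rewrite big1 // => j _; rewrite mcoeffZ memN_msupp_eq0 ?mulr0 //.
apply: msize_mdeg_ge; apply: leq_trans (ltnW (msize_prodF _)) _; apply: leq_trans hi _.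
by rewrite mdegE (bigD1 i) //= leq_addr.
Qed.

End AlgebraicDependence.

Section HeightBound.
Variables (k : fieldType) (n : nat).
Let R := {mpoly k[n]}.
Implicit Types P : set R.

Definition independent_mod P d (y : 'I_d -> R) :=
  forall G : {mpoly k[d]}, P (mmap (@mpolyC n k) y G) -> G = 0.

Lemma factor_last_var d (G : {mpoly k[d.+1]}) : G != 0 ->
  exists j G1, G = var k d.+1 d ^+ j * G1 /\ restr G1 != 0.
Proof.
have [l] := ubnP (msize G); elim: l G => // l ih G hl G0.
have [r0|r0] := eqVneq (restr G) 0; last by exists 0%N, G; rewrite expr0 mul1r.
have [g e] := mwiden_restr G; rewrite r0 mwiden0 add0r in e.
have g0 : g != 0 by apply: contraNneq G0 => g0; rewrite e g0 mulr0.
have X0 : var k d.+1 d != 0.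
  by apply: contraNneq G0 => X0; rewrite e X0 mul0r.
have [|j [G1 [e1 h1]]] := ih g _ g0.
  have := msizeM X0 g0; rewrite -e -[d in var _ _ d]/(val (@ord_max d)) var_ord msizeX mdeg1.
  by move=> em; move: hl; rewrite em add2n /= ltnS.
by exists j.+1, G1; split=> //; rewrite exprS -mulrA -e1.
Qed.

(** The new element f is in P1 but not in P0. In a relation modulo P0, powers of f can be cancelled;
    modulo P1 what remains free of f is then a relation between the old elements. *)
Lemma independent_extend (P0 P1 : set R) d (y : 'I_d -> R) : prime_ideal P0 -> prime_ideal P1 ->
  P0 `<` P1 -> independent_mod P1 y -> exists z : 'I_d.+1 -> R, independent_mod P0 z.
Proof.
move=> h0 h1 [h01 nh] hy; have i1 := prime_ideal_is_ideal h1.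
have [f [f1 f0]] : exists f, P1 f /\ ~ P0 f.
  by apply: contrapT => hno; apply: nh => f f1; apply: contrapT => nf; apply: hno; exists f.
pose z (i : 'I_d.+1) : R := if insub (i : nat) is Some j then y j else f.
exists z => G hG; apply/eqP; apply: contrapT => /negP G0.
have [j [G1 [e1 r1]]] := factor_last_var G0.
have zlast : mmap (@mpolyC n k) z (var k d.+1 d) = f.
  by rewrite -[d in var _ _ d]/(val (@ord_max d)) var_ord mmapXU /z insubF //= ltnn.
have : P0 (mmap (@mpolyC n k) z G1).
  by move: hG; rewrite e1 rmorphM rmorphXn /= zlast => /(prime_idealM h0)[/(prime_idealX h0)|].
move/h01; have [g e] := mwiden_restr G1; rewrite e rmorphD rmorphM /= zlast => h.
have : P1 (mmap (@mpolyC n k) z (mwiden (restr G1))).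
  rewrite -[mmap _ _ _](addrK (f * mmap (@mpolyC n k) z g)).
  by apply: is_idealB => //; apply: is_idealMr.
rewrite /mwiden rmorph_mmap (eq_mmap (f' := @mpolyC n k) (h' := y)) => [|x|i] /=.
- by move/hy => r0; rewrite r0 eqxx in r1.
- by rewrite mmapC.
- by rewrite mmapXU /z /= valK.
Qed.

(** Each step down the chain adds one independent element, and [algebraic_dependence] allows at most
    n of them. *)
Lemma height_bound P h d (y : 'I_d -> R) : height_ge P h -> independent_mod P y ->
  (h + d <= n)%N.
Proof.
move=> [p [hp hlt <-]] hy.
have [z hz] : exists z : 'I_(h + d) -> R, independent_mod (p 0%N) z.
  elim: h p hp hlt hy => [|h ih] p hp hlt hy; first by exists y.
  have [i hi|i hi||z hz] := ih (fun i => p i.+1).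
  - exact: hp.
  - exact: hlt.
  - exact: hy.
  exact: (independent_extend (hp 0%N isT) (hp 1%N isT) (hlt 0%N isT) hz).
rewrite leqNgt; apply/negP => /(algebraic_dependence z) [G [G0 hG]].
move/eqP: G0; apply; apply: hz; rewrite hG.
exact: (is_ideal0 (prime_ideal_is_ideal (hp 0%N _))).
Qed.

Lemma height_ge_sup P P' h : prime_ideal P' -> P `<=` P' -> height_ge P h -> height_ge P' h.
Proof.
move=> hP' sub [p [hp hlt e]].
exists (fun i => if i == h then P' else p i); split; last by rewrite eqxx.
  by move=> i hi; case: eqP => // _; exact: hp.
move=> i hi; rewrite (ltn_eqF hi); case: eqP => [ei|_]; last exact: hlt.
have [h1 h2] := hlt i hi; rewrite ei e in h1 h2.
by split=> [x /h1/sub|h3] //; apply: h2 => x /sub/h3.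
Qed.

Lemma height_ge_pred P h : height_ge P h.+1 -> height_ge P h.
Proof.
move=> [p [hp hlt e]]; exists (fun i => p i.+1); split=> // i hi; [exact: hp|exact: hlt].
Qed.

Lemma height_ge_leq P h h' : (h <= h')%N -> height_ge P h' -> height_ge P h.
Proof. by move=> /subnK <-; elim: (_ - _)%N => // j ih /height_ge_pred. Qed.

Lemma codim_ge_prime P h : height_ge P h -> codim_ge P h.
Proof. by move=> hP P' hP' sub; apply: height_ge_sup hP. Qed.

End HeightBound.

(** * The height of the ideal of minors *)

Lemma det_perm_neq0 (R : comNzRingType) n (s : 'I_n -> 'I_n) : injective s ->
  \det (\matrix_(i, j) (s i == j)%:R) != 0 :> R.
Proof.
move=> inj; have -> : \matrix_(i, j) (s i == j)%:R = perm_mx (perm inj) :> 'M[R]_n.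
  by apply/matrixP => i j; rewrite !mxE permE.
by rewrite det_perm signr_eq0.
Qed.

Lemma det_eq0_of_kernel (R : comNzRingType) n (A : 'M[R]_n) (v : 'cV[R]_n) i :
  v i 0 = 1 -> A *m v = 0 -> \det A = 0.
Proof.
move=> vi Av; have : \adj A *m A *m v = 0 by rewrite -mulmxA Av mulmx0.
by rewrite mul_adj_mx mul_scalar_mx => /matrixP/(_ i 0); rewrite !mxE vi mulr1.
Qed.

Section Heights.
Variables (k : fieldType) (s e : nat).
Let N := (s.+3 + e)%N.
Hypothesis e1 : (1 <= e)%N.
Let R := {mpoly k[N]}.

Definition mask (L : nmodType) (U : pred nat) (u : nat -> L) j : L := if U j then u j else 0.

Definition masked_param (U : pred nat) : R -> {mpoly k[s + N]} :=
  evalpt (@mpolyC (s + N) k) s N (gen_c k s N) (mask U (gen_u k s N)).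
HB.instance Definition _ U := GRing.RMorphism.on (masked_param U).

Definition masked_kernel U : set R := [set p | masked_param U p = 0].

Lemma masked_kernel_prime U : prime_ideal (masked_kernel U).
Proof. exact: kernel_prime_ideal (masked_param U). Qed.

Lemma masked_kernel_evalpt (L : comNzRingType) (f : {rmorphism k -> L}) U c u p :
  masked_kernel U p -> evalpt f s N c (mask U u) p = 0.
Proof.
rewrite /masked_kernel /= => hp.
pose h (i : 'I_(s + N)) := if (i < s)%N then c i else u (i - s)%N.
rewrite -(rmorph0 (mmap f h)) -{}hp [X in _ = X]rmorph_evalpt /evalpt.
apply: eq_mmap => [x|t]; first by rewrite /= mmapC.
apply: eq_rat_coef => i hi /=.
  by rewrite /gen_c /var insubT ?ltn_addr // => h'; rewrite mmapXU /h /= hi.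
rewrite /mask; case: ifP => _; last by rewrite rmorph0.
rewrite /gen_u /var insubT ?ltn_add2l // => h'; rewrite mmapXU /h /=.
by rewrite ltnNge leq_addr addKn.
Qed.

Lemma masked_kernelS (U U' : pred nat) : (forall j, U j -> U' j) ->
  masked_kernel U' `<=` masked_kernel U.
Proof.
move=> sub p hp; rewrite /masked_kernel /= /masked_param.
rewrite -[RHS](masked_kernel_evalpt (@mpolyC (s + N) k) (gen_c k s N) (mask U (gen_u k s N)) hp).
apply: eq_mmap => [x|t]; first by [].
rewrite /rat_point; apply: eq_rat_coef => i _; first by [].
rewrite /mask.
by case Ui: (U i); rewrite ?(sub _ Ui) //; case: ifP.
Qed.

Lemma rat_coef_mask (L : comNzRingType) c (u : nat -> L) n : (n < N)%N ->
  rat_coef s N c (mask (ltn^~ e) u) n = rat_coef s e c u n.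
Proof.
apply: rat_coef_unique => j jN; rewrite rat_coef_rec jN; congr (_ - _).
Qed.

Lemma masked_kernel_param p : masked_kernel (ltn^~ e) p <-> param s e p = 0.
Proof.
have h (L : comNzRingType) (f : {rmorphism k -> L}) c u :
    evalpt f s N c (mask (ltn^~ e) u) p = evalpt f s e c u p.
  apply: eq_mmap => [x|t]; first by [].
  rewrite /rat_point rat_coef_mask //.
  by have := ltn_ord t; lia.
split=> [hp|hp]; first by rewrite /param -h; exact: masked_kernel_evalpt.
rewrite /masked_kernel /= /masked_param h; exact: param_evalpt.
Qed.

(** The chain of primes below P comes from numerators that may also be nonzero in the last q degrees
    below N, for q = 3, 2, 1, 0. *)
Definition free_ends q j := ((j < e) || (N - q <= j))%N.

(** Degrees in which the recurrence is imposed: e, ..., e + s - 1 and N - 1 - q. These are s + 1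
    linear equations in the entries of (1, c), so their determinant vanishes while the numerator is
    zero there; passing from q to q + 1 frees the degree N - 1 - q. *)
Let row q (a : nat) := if (a < s)%N then (e + a)%N else (N.-1 - q)%N.

Let entry q (a i : nat) : R :=
  if (i <= row q a)%N then var k N (N.-1 - (row q a - i)) else 0.

Let recurrence_mx q : 'M[R]_s.+1 := \matrix_(a, i) entry q a i.

Let row_lt q a : (row q a < N)%N.
Proof. by rewrite /row; case: ifP; rewrite /N; lia. Qed.

Let evalpt_entry (L : comNzRingType) (f : {rmorphism k -> L}) q c u a i :
  evalpt f s N c u (entry q a i) =
  if (i <= row q a)%N then rat_coef s N c u (row q a - i) else 0.
Proof.
rewrite /entry; case: ifP => h; last by rewrite rmorph0.
have := row_lt q a; rewrite evalpt_var => hr.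
by rewrite ifT; [congr rat_coef; lia|lia].
Qed.

Let recurrence_in_kernel q : (q <= 2)%N ->
  masked_kernel (free_ends q) (\det (recurrence_mx q)).
Proof.
move=> q2; rewrite /masked_kernel /= -det_map_mx.
pose c := gen_c k s N; pose v : 'cV[{mpoly k[s + N]}]_s.+1 :=
  \col_i if (i : nat) is i'.+1 then c i' else 1.
apply: (@det_eq0_of_kernel _ _ _ v ord0); first by rewrite mxE.
apply/matrixP => a b; rewrite !mxE big_ord_recl !mxE mulr1 /=.
have entryE i : masked_param (free_ends q) (entry q a i) = _ := evalpt_entry _ q _ _ a i.
rewrite entryE leq0n subn0 rat_coef_rec row_lt {1}/mask ifF; last first.
  by rewrite /free_ends /row; case: ifP; rewrite /N; lia.
rewrite sub0r; apply/eqP; rewrite addrC subr_eq0; apply/eqP; apply: eq_bigr => i _.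
by rewrite !mxE /= entryE /bump /= add1n mulrC.
Qed.

Let recurrence_nkernel q : (q <= 2)%N ->
  ~ masked_kernel (free_ends q.+1) (\det (recurrence_mx q)).
Proof.
(* With c = 0 and u equal to 1 in degrees e - 1 and N - 1 - q only, the recurrence matrix becomes a
   permutation matrix. *)
move=> q2; pose u j : k := ((j == e.-1) || (j == N.-1 - q)%N)%:R.
move/(masked_kernel_evalpt idfun (fun=> 0) u); rewrite -det_map_mx.
have wE j : rat_coef s N (fun=> 0) (mask (free_ends q.+1) u) j =
    ((j == e.-1) || (j == N.-1 - q)%N)%:R.
  rewrite rat_coef_rec big1 => [|i _]; last by rewrite mul0r.
  rewrite subr0 /mask /u /free_ends; case: ifP => [_|jN].
    by case: ifP => //; case: eqP; case: eqP => //=; rewrite /N; lia.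
  by case: eqP; case: eqP => //=; move: jN e1; rewrite /N; lia.
pose sg (a : 'I_s.+1) : 'I_s.+1 := if (a < s)%N then inord a.+1 else ord0.
have inj : injective sg.
  move=> a b; rewrite /sg; have := ltn_ord a; have := ltn_ord b.
  case: ifP => ha; case: ifP => hb hb' ha' /(congr1 val); rewrite /= ?inordK ?ltnS //.
  - by case=> ab; apply: val_inj.
  - by move=> _; apply: val_inj => /=; lia.
rewrite [X in \det X](_ : _ = \matrix_(a, i) (sg a == i)%:R).
  by move/eqP; rewrite (negPf (det_perm_neq0 _ inj)).
apply/matrixP => a i; rewrite !mxE [LHS]evalpt_entry wE.
have hi := ltn_ord i; have ha := ltn_ord a.
have vs : val (sg a) = if (a < s)%N then a.+1 else 0%N.
  by rewrite /sg; case: ifP => h //; rewrite /= inordK ?ltnS.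
rewrite -(inj_eq val_inj) vs /row /N /=; move: q2 e1 hi ha.
by case: (ltnP a s) => has q2' e1' hi ha; case: ifP => h1;
  do ![case: eqP => ?] => //=; exfalso; lia.
Qed.

Lemma height_kernel_ge : height_ge [set p : R | param s e p = 0] 3.
Proof.
exists (fun i => masked_kernel (free_ends (3 - i))); split=> [i _|i i3|].
- exact: masked_kernel_prime.
- split; first by apply: masked_kernelS => j; rewrite /free_ends; lia.
  have -> : (3 - i = (3 - i.+1).+1)%N by lia.
  have q2 : (3 - i.+1 <= 2)%N by lia.
  by move=> /(_ _ (recurrence_in_kernel q2)) /(recurrence_nkernel q2).
apply/seteqP; split=> p; rewrite subnn.
  move=> hp; apply/masked_kernel_param; apply: masked_kernelS hp => j.
  by move=> /= h; rewrite /free_ends h.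
move/masked_kernel_param => hp; rewrite /masked_kernel /=.
rewrite -[RHS](masked_kernel_evalpt (@mpolyC (s + N) k) (gen_c k s N) (gen_u k s N) hp).
apply: eq_mmap => [x|t]; first by [].
rewrite /rat_point; apply: eq_rat_coef => i iN; first by [].
by rewrite /mask /free_ends subn0 [(N <= i)%N]leqNgt iN orbF.
Qed.

(** Any generic values of w_0, ..., w_(e+s-1) are attained: the recurrences in degrees e, ..., e + s
    - 1 form a linear system for c with matrix [A], and u is then read off. *)
Lemma independent_first_coefs :
  independent_mod [set p : R | param s e p = 0]
    (fun i : 'I_(e + s) => var k N (N.-1 - i)).
Proof.
set d := (e + s)%N; pose T := {mpoly k[d]}; pose K := {fraction T}.
pose Y j : K := tofrac (var k d j).
pose A : 'M[T]_s := \matrix_(a, i) (if (i < e + a)%N then var k d (e + a - i.+1) else 0).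
have detA : \det A != 0.
  (* Setting the variable of index e - 1 to 1 and the others to 0 turns [A] into the identity. *)
  pose v (i : 'I_d) : k := (i == e.-1 :> nat)%:R.
  have hv t : (var k d t).@[v] = ((t < d) && (t == e.-1))%N%:R.
    rewrite /var; case: insubP => [i -> <-|/negPf ->]; last by rewrite meval0.
    by rewrite mevalXU.
  have : (\det A).@[v] != 0.
    rewrite -det_map_mx (_ : map_mx _ A = 1%:M) ?det1 ?oner_eq0 //.
    apply/matrixP => a i; rewrite !mxE -(inj_eq val_inj) /=.
    have ha := ltn_ord a; have hi := ltn_ord i.
    case: ifP => h /=; last by rewrite meval0; case: eqP => // ai; move: h; rewrite -ai; lia.
    rewrite hv; congr (nat_of_bool _)%:R; move: e1 h; rewrite /d.
    by do !case: eqP; lia.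
  by apply: contraNneq => ->; rewrite meval0.
pose B := map_mx (@tofrac T) A.
have uB : B \in unitmx by rewrite unitmxE det_map_mx unitfE tofrac_eq0.
pose cv := - (invmx B *m \col_a Y (e + a)%N).
pose c i : K := if insub i is Some i' then cv i' 0 else 0.
pose u j : K := Y j + \sum_(i < s) c i * (if (i < j)%N then Y (j - i.+1)%N else 0).
have cE (i : 'I_s) : c i = cv i 0 by rewrite /c valK.
have wE j : (j < d)%N -> rat_coef s e c u j = Y j.
  apply: rat_coef_unique => {}j jd; case: ltnP => je; first by rewrite /u addrK.
  have js : (j - e < s)%N by move: jd; rewrite /d; lia.
  have : (B *m cv) (Ordinal js) 0 = - Y j.
    by rewrite mulmxN mulKVmx // !mxE /= subnKC.
  rewrite !mxE => h; rewrite sub0r -[Y j]opprK -h; congr (- _).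
  apply: eq_bigr => i _; rewrite cE !mxE /= subnKC // mulrC; congr (_ * _).
  by case: ifP; rewrite ?rmorph0.
move=> G /= hG; apply/eqP; rewrite -(tofrac_eq0 G); apply/eqP.
have := param_evalpt (@tofrac T \o @mpolyC d k) c u hG.
have GE : mmap (@mpolyC d k) (fun i => 'X_i) G = G.
  rewrite [RHS]mpolyE; apply: eq_bigr => mu _; by rewrite mul_mpolyC mmap1_id.
rewrite -{2}GE rmorph_mmap /evalpt rmorph_mmap => <-; apply: eq_mmap => [x|i].
  by rewrite /= /evalpt mmapC.
have hi := ltn_ord i; rewrite [LHS]/= -var_ord.
rewrite [RHS](evalpt_var (@tofrac T \o @mpolyC d k) N s e c u (N.-1 - i)).
have -> : (N.-1 - i < N)%N by rewrite /N; lia.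
have -> : (N.-1 - (N.-1 - i) = i)%N by move: hi; rewrite /N /d; lia.
by rewrite wE.
Qed.

Lemma height_kernel_lt n : height_ge [set p : R | param s e p = 0] n -> (n <= 3)%N.
Proof.
move/height_bound => /(_ _ _ independent_first_coefs).
by rewrite /N; lia.
Qed.

End Heights.

(** * Primes containing the gradient ideal *)

Section KillVariables.
Variables (k : fieldType) (N : nat).
Let R := {mpoly k[N]}.

Definition kill (B : pred nat) : R -> R :=
  mmap (@mpolyC N k) (fun t : 'I_N => if B t then 0 else 'X_t).
HB.instance Definition _ B := GRing.RMorphism.on (kill B).

Definition kill_kernel B : set R := [set p | kill B p = 0].

Lemma kill_kernel_prime B : prime_ideal (kill_kernel B).
Proof. exact: kernel_prime_ideal (kill B). Qed.

Lemma kill_var (B : pred nat) t : kill B (var k N t) = if B t then 0 else var k N t.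
Proof.
rewrite /var; case: insubP => [i _ <-|_]; last by rewrite rmorph0; case: ifP.
by rewrite /kill mmapXU.
Qed.

Lemma kill_subr_ideal (B : pred nat) (I : set R) : is_ideal I ->
  (forall t, B t -> I (var k N t)) -> forall p, I (p - kill B p).
Proof.
move=> hI hB; apply: mpoly_subring_ind => [c|i|p q hp hq|p q hp hq].
- by rewrite /kill mmapC subrr; apply: is_ideal0.
- rewrite -var_ord kill_var; case: ifP => [/hB|_]; first by rewrite subr0.
  by rewrite subrr; apply: is_ideal0.
- by rewrite rmorphD opprD addrACA; apply: (is_idealD hI).
have -> : p * q - kill B (p * q) = p * (q - kill B q) + kill B q * (p - kill B p).
  by rewrite rmorphM; ring.
by apply: (is_idealD hI); apply: (is_idealMl _ hI).
Qed.

Lemma kill_kernelE (B : pred nat) :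
  kill_kernel B = ideal_gen [set var k N t | t in [set t | B t]].
Proof.
apply/seteqP; split=> p.
  move=> hp; have hI := is_ideal_gen [set var k N t | t in [set t | B t]].
  have := @kill_subr_ideal B _ hI _ p; rewrite (hp : kill B p = 0) subr0; apply.
  by move=> t Bt; apply: ideal_gen_mem; exists t.
move: p; apply: ideal_gen_sub; first exact: prime_ideal_is_ideal (kill_kernel_prime B).
by move=> _ [t /= Bt <-]; rewrite /kill_kernel /= kill_var Bt.
Qed.

Lemma kill_meval (B : pred nat) (v : 'I_N -> k) p :
  (forall t : 'I_N, B t -> v t = 0) -> kill_kernel B p -> p.@[v] = 0.
Proof.
move=> hv hp; rewrite -(meval0 v) -hp /meval /kill rmorph_mmap.
apply: eq_mmap => [c|t] /=; first by rewrite mmapC.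
by case: ifP => [/hv->|_]; rewrite ?rmorph0 // mmapXU.
Qed.

Lemma height_kill_ge n (h : (n <= N)%N) : height_ge (kill_kernel (leq n)) (N - n).
Proof.
exists (fun i => kill_kernel (fun t => (n <= t < n + i)%N)); split=> [i _|i hi|].
- exact: kill_kernel_prime.
- split.
    rewrite !kill_kernelE => p; apply: ideal_gen_sub; first exact: is_ideal_gen.
    move=> _ [t /= /andP[h1 h2] <-]; apply: ideal_gen_mem; exists t => //=.
    by rewrite h1 addnS ltnS ltnW.
  move=> /(_ (var k N (n + i))); rewrite /kill_kernel /= !kill_var leq_addr addnS !ltnS leqnn ltnn.
  move=> /(_ erefl); rewrite /var insubT; first by lia.
  by move=> h' /eqP; rewrite -mleadc_eq0 mleadXm mcoeffX eqxx oner_eq0.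
have eB p : kill (fun t => (n <= t < n + (N - n))%N) p = kill (leq n) p.
  apply: eq_mmap => [x|t]; first by [].
  by rewrite subnKC // ltn_ord andbT.
by apply/seteqP; split=> p; rewrite /kill_kernel /= eB.
Qed.

Lemma height_kill_lt n (h : (n <= N)%N) j : height_ge (kill_kernel (leq n)) j -> (j <= N - n)%N.
Proof.
move/height_bound => /(_ n (fun i => var k N i)) H.
suff : (j + n <= N)%N by lia.
apply: H => G; rewrite /kill_kernel /= => hG.
have : mmap (@mpolyC N k) (fun i : 'I_n => var k N i) G = 0.
  rewrite -[RHS]hG /kill rmorph_mmap; apply: eq_mmap => [c|i] /=; first by rewrite mmapC.
  by rewrite -/(kill (leq n) (var k N i)) kill_var leqNgt ltn_ord.
move/(congr1 (mmap (@mpolyC n k) (fun t : 'I_N => var k n t))); rewrite rmorph0 rmorph_mmap => <-.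
rewrite -[LHS](_ : mmap (@mpolyC n k) (fun i => 'X_i) G = G); last first.
  by rewrite [RHS]mpolyE; apply: eq_bigr => mu _; rewrite mul_mpolyC mmap1_id.
apply: eq_mmap => [c|i] /=; first by rewrite mmapC.
have iN : (i < N)%N by exact: leq_trans h.
by rewrite -[var k N i]/(var k N (Ordinal iN)) var_ord mmapXU var_ord.
Qed.

End KillVariables.

Lemma factor_lift n (f : 'I_n -> 'I_n.+1) :
  exists (p : 'I_n.+1) (h : 'I_n -> 'I_n), forall i, f i = lift p (h i).
Proof.
have [p hp] : exists p, p \notin codom f.
  apply: contrapT => hno; have : (#|'I_n.+1| <= size (codom f))%N.
    apply: leq_trans (card_size _); apply: subset_leq_card; apply/fintype.subsetP => p _.
    by apply: contrapT => /negP np; apply: hno; exists p.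
  by rewrite size_codom !card_ord ltnn.
have /choice [h hh] (i : 'I_n) : exists j, f i = lift p j.
  have ne : p != f i by apply: contraNneq hp => ->; exact: codom_f.
  by have [j ->] := unlift_some ne; exists j.
by exists p, h.
Qed.

Section Cover.
Variables (k : fieldType) (N m : nat).
Hypotheses (char0 : [pchar k] =i pred0).
Let R := {mpoly k[N]}.
Let H := hankel_mx k N m.+1.
Let J := gradient_ideal (\det H).
Let P := minors_ideal m H.

Lemma mderiv_var (t : 'I_N) l : (var k N l)^`M(t) = (l == t :> nat)%:R.
Proof.
rewrite /var; case: insubP => [i _ <-|hl].
  rewrite mderivX mnm1E; case: eqP => [->|ne].
    by rewrite eqxx scale1r (_ : _ - _ = 0)%MM ?mpolyX0 //; apply/mnmP => j; rewrite mnmBE subnn mnm0E.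
  by rewrite scale0r; case: eqP => // /val_inj.
by rewrite mderiv0; case: eqP => // e; rewrite e ltn_ord in hl.
Qed.

Lemma mderiv_det_hankel (t : 'I_N) :
  (\det H)^`M(t) = \sum_(i < m.+1) \sum_(j < m.+1 | (i + j)%N == t) cofactor H i j.
Proof.
rewrite mderiv_det; apply: eq_bigr => i _; rewrite [RHS]big_mkcond; apply: eq_bigr => j _.
by rewrite mxE mderiv_var; case: eqP; rewrite ?mul1r ?mul0r.
Qed.

Lemma gradient_sub_minors : J `<=` P.
Proof.
have hP : is_ideal P := is_ideal_gen _.
apply: ideal_gen_sub => // _ [t _ <-]; rewrite mderiv_det_hankel.
apply: (is_ideal_sum _ hP) => i _; apply: (is_ideal_sum _ hP) => j _.
apply: (is_idealMl _ hP); apply: ideal_gen_mem; exists (lift i), (lift j).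
have hl (a : 'I_m.+1) : {homo lift a : x y / (x < y)%N}.
  by move=> x y; rewrite /= /bump; case: leqP; case: leqP; lia.
by split=> //; congr (\det _); apply/matrixP => x y; rewrite !mxE.
Qed.

Lemma prime_over_gradient p : prime_ideal p -> J `<=` p ->
  P `<=` p \/ kill_kernel (leq m) `<=` p.
Proof.
move=> hp Jp; have [K [f hf]] := prime_ideal_kernel hp.
pose y t := f (var k N t); pose HK : 'M[K]_m.+1 := \matrix_(i, j) y (i + j)%N.
have HKE : HK = map_mx f H by apply/matrixP => i j; rewrite !mxE.
have hgrad t : (t < N)%N -> \sum_(i < m.+1) \sum_(j < m.+1 | (i + j)%N == t) cofactor HK i j = 0.
  move=> tN; have : f (\det H)^`M(Ordinal tN) = 0.
    by apply/hf/Jp; apply: ideal_gen_mem; exists (Ordinal tN).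
  rewrite mderiv_det_hankel rmorph_sum => h; rewrite -[RHS]h; apply: eq_bigr => i _.
  by rewrite rmorph_sum; apply: eq_bigr => j _; rewrite HKE cofactor_map_mx.
have yN t : (N <= t)%N -> y t = 0 by move=> h; rewrite /y var_out // rmorph0.
have hdet : \det HK = 0.
  (* Summing the expansions along all rows gives m + 1 times the determinant; grouped by variable,
     the same sum is a combination of the partial derivatives. *)
  have m0 : m.+1%:R != 0 :> K.
    have -> : m.+1%:R = (f \o @mpolyC N k) m.+1%:R by rewrite rmorph_nat.
    by rewrite fmorph_eq0 ((pcharf0P k).1 char0).
  apply: (mulfI m0); rewrite mulr0.
  transitivity (\sum_(i < m.+1) \sum_(j < m.+1) y (i + j)%N * cofactor HK i j).
    transitivity (\sum_(i < m.+1) \det HK); first by rewrite sumr_const card_ord mulr_natl.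
    apply: eq_bigr => i _.
    by rewrite (expand_det_row _ i); apply: eq_bigr => j _; rewrite mxE.
  transitivity (\sum_(t < N) y t * \sum_(i < m.+1) \sum_(j < m.+1 | (i + j)%N == t) cofactor HK i j).
    under [RHS]eq_bigr do rewrite mulr_sumr.
    rewrite [RHS]exchange_big /=; apply: eq_bigr => i _.
    under [RHS]eq_bigr do rewrite mulr_sumr big_mkcond.
    rewrite [RHS]exchange_big /=; apply: eq_bigr => j _.
    have [ijN|ijN] := ltnP (i + j)%N N; last first.
      by rewrite yN // mul0r big1 // => t _; case: eqP => // e; have := ltn_ord t; rewrite -e ltnNge ijN.
    rewrite (bigD1 (Ordinal ijN)) //= eqxx big1 ?addr0 // => t ne.
    by case: eqP => // e; case/eqP: ne; apply: val_inj.
  by rewrite big1 // => t _; rewrite hgrad ?mulr0.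
have [hcof|hno] := pselect (exists i j, cofactor HK i j != 0).
  right; rewrite kill_kernelE; apply: ideal_gen_sub; first exact: prime_ideal_is_ideal.
  move=> _ [t /= mt <-]; apply/hf.
  exact: (hankel_gradient_eq0 yN hdet hgrad hcof).
left; apply: ideal_gen_sub; first exact: prime_ideal_is_ideal.
move=> _ [a [b [_ _ ->]]]; apply/hf; rewrite -det_map_mx map_mxsub -HKE.
apply: contrapT => /eqP hd; apply: hno.
(* The chosen rows and columns each miss an index, so a nonzero minor would make the cofactor at the
   missed position nonzero. *)
have [p0 [h ha]] := factor_lift a; have [q0 [h' hb]] := factor_lift b.
exists p0, q0; rewrite mulf_neq0 ?signr_eq0 //.
move: hd; rewrite (_ : mxsub a b HK = mxsub h h' (row' p0 (col' q0 HK))); last first.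
  by apply/matrixP => x z; rewrite !mxE ha hb.
move/det_mxsub_neq0 => hr; rewrite -unitfE -unitmxE -row_full_unit /row_full eqn_leq hr.
by rewrite rank_leq_col.
Qed.

End Cover.

(** * The components of the gradient ideal *)

Lemma ideal_exp_exp (R : comNzRingType) (I : set R) g n : I g -> ideal_exp I n (g ^+ n).
Proof.
move=> Ig; elim: n => [|n ih] //; rewrite exprS.
by apply: ideal_gen_mem; exists g, (g ^+ n).
Qed.

(** For g in I, g^(n+1) would lie in J I^n, hence in the prime Q, and so would g. *)
Lemma not_reduction (R : comNzRingType) (J I Q : set R) : prime_ideal Q -> J `<=` Q ->
  ~ I `<=` Q -> ~ is_reduction J I.
Proof.
move=> hQ JQ nIQ [_ [n e]]; apply: nIQ => g /(ideal_exp_exp n.+1); rewrite e => hg.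
apply: (prime_idealX hQ); move: hg; apply: ideal_gen_sub; first exact: prime_ideal_is_ideal.
by move=> _ [a [b [/JQ Ja _ ->]]]; apply: is_idealMr => //; exact: prime_ideal_is_ideal.
Qed.

Section Codim.
Variable R : comNzRingType.
Implicit Types (I J P x : set R).

Definition unmixed_prime J x := exists c, has_codim J c /\ has_codim x c.

(** A smaller prime x' over J has height at least c, so every prime containing x would have height
    at least c + 1. *)
Lemma unmixed_prime_minimal J x : prime_ideal x -> J `<=` x -> unmixed_prime J x ->
  minimal_prime J x.
Proof.
move=> hx Jx [c [[cJ _] [_ cx]]]; split=> // x' hx' Jx' sub.
apply: contrapT => ne; apply: cx => y hy xy.
have [p [hp hlt e]] := cJ x' hx' Jx'.
exists (fun i => if (i <= c)%N then p i else y); split=> [i _|i|].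
- by case: ifP => // ic; exact: hp.
- rewrite ltnS; case: (ltngtP i c) => // [ic _|-> _]; first exact: hlt.
  rewrite e; split; first by move=> z /sub/xy.
  by move=> yx'; apply: ne; apply/seteqP; split=> // z /xy/yx'.
by rewrite ltnn.
Qed.

Lemma component_eq J (S S' : set R -> Prop) :
  (forall x, prime_ideal x -> J `<=` x -> S x <-> S' x) -> component J S = component J S'.
Proof.
move=> h; apply/seteqP; split=> f [n [q [hq hS]]]; exists n, q; split=> // i hi; apply: hS;
  apply/h => //; case: (hq) => hp hJ _ _; try exact: primary_radical_prime;
  by move=> z; rewrite hJ => /(_ i Logic.I); exact: sub_radical.
Qed.

(** A power of an element of P outside Q lies in the P-primary component, hence in the unmixed
    component, but not in the Q-primary component. *)
Lemma component_neq J P Q :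
  (exists n (q : 'I_n -> set R), irredundant_primary_decomposition J q) ->
  minimal_prime J P -> minimal_prime J Q -> ~ P `<=` Q ->
  (forall x, prime_ideal x -> J `<=` x -> unmixed_prime J x -> x = P) ->
  unmixed_component J <> minimal_component J.
Proof.
move=> [n [q hq]] hP hQ nPQ hU e.
have [i0 hi0] := minimal_prime_radical hP hq.
have [g [Pg nQg]] : exists g, P g /\ ~ Q g.
  by apply: contrapT => h; apply: nPQ => g Pg; apply: contrapT => nQg; apply: h; exists g.
have [l hl] : radical (q i0) g by rewrite hi0.
have : unmixed_component J (g ^+ l).
  exists n, q; split=> // i hi; have [hprim hJ hinj _] := hq.
  suff -> : i = i0 by [].
  apply: hinj; rewrite hi0; apply: hU hi; first exact: primary_radical_prime.
  by move=> z; rewrite hJ => /(_ i Logic.I); exact: sub_radical.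
rewrite e => -[n' [q' [hq' hmin]]].
have [j hj] := minimal_prime_radical hQ hq'.
have [hQ1 _ _] := hQ; apply: nQg; apply: (prime_idealX (n := l) hQ1).
by rewrite -hj; apply: sub_radical; apply: hmin; rewrite hj.
Qed.

End Codim.

Section Main.
Variables (k : fieldType) (s e : nat).
Hypotheses (char0 : [pchar k] =i pred0) (s1 : (1 <= s)%N) (e1 : (1 <= e)%N) (es : (e < s)%N).
Let N := (s.+3 + e)%N.
Let R := {mpoly k[N]}.
Let H := hankel_mx k N s.+2.
Let J := gradient_ideal (\det H).
Let P := minors_ideal s.+1 H.
Let Q : set R := kill_kernel (leq s.+1).

Lemma minors_idealE : P = [set p : R | param s e p = 0].
Proof.
apply/seteqP; split=> p.
  have h : (s.+2 + e < N)%N by rewrite /N; lia.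
  by have := @minors_sub_param k N s.+2 e isT h p; rewrite subn2.
rewrite /P /H /R /N in p *; case: e e1 p => // e' _; rewrite addnS => p.
exact: param_kernel.
Qed.

Lemma minors_prime : prime_ideal P.
Proof. by rewrite minors_idealE; exact: kernel_prime_ideal (@param k N s e). Qed.

(** Modulo Q the last row and column vanish, so only the cofactor at (s + 1, s + 1) can survive. It
    belongs to index 2 s + 2, which is at least N because e < s. *)
Lemma gradient_sub_kill : J `<=` Q.
Proof.
apply: ideal_gen_sub => [|_ [t _ <-]]; first exact: prime_ideal_is_ideal (kill_kernel_prime k N _).
rewrite mderiv_det_hankel /Q /kill_kernel /= rmorph_sum big1 // => i _.
rewrite rmorph_sum big1 // => j /eqP ijt; rewrite -cofactor_map_mx /cofactor.
have [im|im] := eqVneq i ord_max; last first.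
  have [a ea _] := unlift_some im; rewrite (expand_det_row _ a) big1 ?mulr0 // => b _.
  by rewrite !mxE -ea /= kill_var ifT ?mul0r //= leq_addr.
have [jm|jm] := eqVneq j ord_max; last first.
  have [a ea _] := unlift_some jm; rewrite (expand_det_col _ a) big1 ?mulr0 // => b _.
  by rewrite !mxE -ea /= kill_var ifT ?mul0r //= leq_addl.
by have := ltn_ord t; move: ijt; rewrite im jm /= /N; move: es; lia.
Qed.

(** At the point where x_s (counted from 0) is 1 and all other variables are 0, the top left minor
    of order s + 1 is that of an antidiagonal permutation matrix. *)
Lemma minors_not_sub_kill : ~ P `<=` Q.
Proof.
pose f : 'I_s.+1 -> 'I_s.+2 := widen_ord (leqnSn _).
move=> /(_ (\det (mxsub f f H))) h.
have : Q (\det (mxsub f f H)).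
  by apply: h; apply: ideal_gen_mem; exists f, f; split.
pose v (t : 'I_N) : k := (t == s :> nat)%:R.
have v0 (t : 'I_N) : (s.+1 <= t)%N -> v t = 0.
  by move=> ht; rewrite /v; case: eqP => // et; rewrite et ltnn in ht.
move/(kill_meval v0); rewrite -det_map_mx => hv.
have /eqP[] := det_perm_neq0 k (@rev_ord_inj s.+1); rewrite -[RHS]hv.
congr (\det _); apply/matrixP => i j; rewrite !mxE /var.
have hi := ltn_ord i; have hj := ltn_ord j.
case: insubP => [t _ et|hN]; last first.
  rewrite rmorph0 -(inj_eq val_inj) /=; case: eqP => // h1; move: hN; rewrite /= /N.
  by move: h1; lia.
rewrite /= mevalXU /v [t : nat]et -(inj_eq val_inj) /=; congr (nat_of_bool _)%:R.
by do !case: eqP => //=; lia.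
Qed.

(** The last variable is w_0, whose value at the generic point is u_0. *)
Lemma kill_not_sub_minors : ~ Q `<=` P.
Proof.
move=> /(_ (var k N N.-1)); rewrite /Q /kill_kernel /= kill_var ifT; last by rewrite /N; lia.
move=> /(_ erefl); rewrite minors_idealE /= /param evalpt_var ltnSn subnn rat_coef_rec e1.
rewrite big1 ?subr0 => [|i _]; last by rewrite mulr0.
rewrite /gen_u addn0 /var insubT; first by rewrite -[X in (X < _)%N]addn0 ltn_add2l.
by move=> h /eqP; rewrite -mleadc_eq0 mleadXm mcoeffX eqxx oner_eq0.
Qed.

Lemma gradient_cover x : prime_ideal x -> J `<=` x -> P `<=` x \/ Q `<=` x.
Proof. exact: prime_over_gradient. Qed.

Lemma minors_minimal : minimal_prime J P.
Proof.
split; [exact: minors_prime|exact: gradient_sub_minors|].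
move=> x hx Jx xP; case: (gradient_cover hx Jx) => [Px|Qx]; first exact/seteqP.
by case: kill_not_sub_minors => z /Qx/xP.
Qed.

Lemma kill_minimal : minimal_prime J Q.
Proof.
split; [exact: kill_kernel_prime|exact: gradient_sub_kill|].
move=> x hx Jx xQ; case: (gradient_cover hx Jx) => [Px|Qx]; last exact/seteqP.
by case: minors_not_sub_kill => z /Px/xQ.
Qed.

Lemma minimal_primeE x : minimal_prime J x <-> x = Q \/ x = P.
Proof.
split=> [[hx Jx hmin]|[->|->]]; [|exact: kill_minimal|exact: minors_minimal].
case: (gradient_cover hx Jx) => [Px|Qx]; [right|left]; apply/esym; apply: hmin => //.
- exact: minors_prime.
- exact: gradient_sub_minors.
- exact: kill_kernel_prime.
- exact: gradient_sub_kill.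
Qed.

Let height_P n : height_ge P n <-> (n <= 3)%N.
Proof.
rewrite minors_idealE; split; first exact: height_kernel_lt.
by move=> h; apply: height_ge_leq h _; exact: height_kernel_ge.
Qed.

Let height_Q n : height_ge Q n <-> (n <= e.+2)%N.
Proof.
have h : (s.+1 <= N)%N by rewrite /N; lia.
have -> : e.+2 = (N - s.+1)%N by rewrite /N; lia.
split; first exact: height_kill_lt.
by move=> hn; apply: height_ge_leq hn _; exact: height_kill_ge.
Qed.

Let has_codim_prime (x : set R) c : prime_ideal x -> height_ge x c -> ~ height_ge x c.+1 -> has_codim x c.
Proof.
move=> hx h1 h2; split; first exact: codim_ge_prime.
by move=> h; apply: h2; exact: h.
Qed.

Lemma unmixed_eq_minimal : unmixed_component J = minimal_component J <-> e = 1%N.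
Proof.
have [hP hQ] := (minors_prime, kill_kernel_prime k N (leq s.+1)).
have JP : J `<=` P by exact: gradient_sub_minors.
split=> [heq|e_1].
  apply: contrapT => ne; move: heq; apply: (@component_neq _ J P Q).
  - apply: exists_irredundant_primary_decomposition; first exact: mpoly_acc.
    exact: is_ideal_gen.
  - exact: minors_minimal.
  - exact: kill_minimal.
  - exact: minors_not_sub_kill.
  (* If Q were selected, codim J would be at most 3, the height of P, whereas Q has height e + 2 >=
     4. *)
  move=> x hx Jx hU; have /minimal_primeE [xQ|//] := unmixed_prime_minimal hx Jx hU.
  case: hU => c [[cJ _] [_ cx]]; case: cx; rewrite xQ; apply: codim_ge_prime.
  apply/height_Q; have /height_P := cJ P hP JP.
  by move: ne e1; lia.
apply: component_eq => x hx Jx; split; first exact: unmixed_prime_minimal.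
move=> hmin; have cJ : has_codim J 3.
  split; last by move=> /(_ P hP JP)/height_P.
  move=> y hy Jy; case: (gradient_cover hy Jy) => sub.
    by apply: (height_ge_sup hy sub); apply/height_P.
  by apply: (height_ge_sup hy sub); apply/height_Q; rewrite e_1.
exists 3; split=> //; case/minimal_primeE: hmin => ->; apply: has_codim_prime => //.
- by apply/height_Q; rewrite e_1.
- by move/height_Q; rewrite e_1.
- exact/height_P.
- by move/height_P.
Qed.

Theorem hankel_gradient_components :
  [/\ [set p | minimal_prime J p] = [set Q; P],
      ~ is_reduction J P
    & unmixed_component J = minimal_component J <-> e = 1%N].
Proof.
split; [|exact: not_reduction (kill_kernel_prime k N _) gradient_sub_kill minors_not_sub_kill|
  exact: unmixed_eq_minimal].
by apply/seteqP; split=> x /minimal_primeE.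
Qed.

End Main.

Lemma last_column_idealE (k : fieldType) N m : (0 < m)%N ->
  ideal_gen [set 'X_t | t in [set t : 'I_N | (m <= t.+1)%N]] =
  kill_kernel (leq m.-1) :> set {mpoly k[N]}.
Proof.
move=> m0; rewrite kill_kernelE; apply/seteqP; split; apply: ideal_gen_sub; try exact: is_ideal_gen.
  move=> _ [t /= mt <-]; apply: ideal_gen_mem; exists (t : nat); last exact: var_ord.
  by rewrite /= -ltnS prednK.
move=> _ [t /= mt <-]; rewrite /var; case: insubP => [i _ ei|_]; last exact: is_ideal0 (is_ideal_gen _).
by apply: ideal_gen_mem; exists i => //=; rewrite ei -(prednK m0) ltnS.
Qed.

Theorem theorem3p9 (k : fieldType) (m r : nat)
  (char0 : [pchar k] =i pred0) (hr : (1 <= r <= m - 3)%N) :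
  let J := gradient_ideal (\det (hankel k m r)) in
  let Q := last_column_ideal k m r in
  let P := minors_ideal (m - 1) (hankel k m r) in
  [/\ [set p | minimal_prime J p] = [set Q; P],
      ~ is_reduction J P
    & unmixed_component J = minimal_component J <-> r = (m - 3)%N].
Proof.
rewrite /last_column_ideal last_column_idealE; last by lia.
have -> : (r = m - 3)%N = (m - 2 - r = 1)%N :> Prop by apply/propext; lia.
rewrite hankelE.
have [s ms] : exists s, m = s.+2 by exists (m - 2)%N; lia.
rewrite ms in hr *.
have -> : (2 * s.+2 - r - 1 = s.+3 + (s - r))%N by lia.
have -> : (s.+2 - 2 - r = s - r)%N by lia.
by apply: hankel_gradient_components => //; lia.
Qed.
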